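(* Let $A$ be a rooted directed tree, let $1\le p<+\infty$, and let $\lambda=(\lambda_v)_{v\in A}$ be a weight such that the induced weighted backward shift $B_\lambda:\ell^p(A)\to\ell^p(A)$ is bounded. The following are equivalent. (i) $B_\lambda$ supports a dense, countably generated, free hypercyclic algebra. (ii) $B_\lambda$ supports a hypercyclic algebra. (iii) There exist an integer $m\ge p$ and $f\in\ell^p(A)$ such that $f^m\in HC(B_\lambda)$. (iv) There is a sequence of positive integers $(n_k)_{k\ge1}$ such that, for every $v\in A$, $$\sup_{u\in\mathrm{Chi}^{n_k}(v)}|\lambda(v\to u)|\xrightarrow{k\to+\infty}+\infty.$$
   Context: All scalars are complex. A directed tree is a connected directed graph $(A,E)$ with countable vertex set $A$ and edge set $E\subset\{(a,b)\in A\times A: a\ne b\}$, having no cycles, and such that each vertex $b$ has at most one parent, i.e. a vertex $a=\mathrm{par}(b)$ with $(a,b)\in E$. There is at most one vertex without a parent, called the root; the tree is rooted if it has a root. $\mathrm{par}^0(b)=b$ and $\mathrm{par}^k(b)=\mathrm{par}(\mathrm{par}^{k-1}(b))$. $\mathrm{Chi}(v)$ is the set of children of $v$ (vertices whose parent is $v$), $\mathrm{Chi}^0(v)=\{v\}$, $\mathrm{Chi}^n(v)=\bigcup_{u\in\mathrm{Chi}^{n-1}(v)}\mathrm{Chi}(u)$. All trees are assumed leafless: every vertex has at least one child (possibly infinitely many). A weight is a family $\lambda=(\lambda_v)_{v\in A}$ of non-zero scalars. The weighted backward shift is $(B_\lambda f)(v)=\sum_{u\in\mathrm{Chi}(v)}\lambda_uf(u)$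 for $f\in\mathbb{C}^A$, $v\in A$. For $u\in\mathrm{Chi}^n(v)$, $n\geq 0$, put $\lambda(v\to u)=\prod_{k=0}^{n-1}\lambda_{\mathrm{par}^k(u)}$. $\ell^p(A)$ is the space of $f\in\mathbb{C}^A$ with $\|f\|_p=(\sum_{v\in A}|f(v)|^p)^{1/p}<\infty$; it is a Banach algebra for the coordinatewise product $(fg)(v)=f(v)g(v)$, and $f^m$ is the $m$-th power for this product. $HC(T)$ is the set of hypercyclic vectors of $T$, i.e. vectors $x$ whose orbit $\{T^nx:n\ge0\}$ is dense. A hypercyclic algebra for $T$ is a subalgebra, not $\{0\}$, contained in $HC(T)\cup\{0\}$. It is dense if it is dense in the whole space, and countably generated and free if it is generated by a countably infinite set $G$ that is algebraically independent: $P(g_1,\dots,g_d)\ne0$ for all $d\geq 1$, distinct $g_1,\dots,g_d\in G$ and every non-zero polynomial $P$ in $d$ commuting variables without constant term. *)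

(* Defs.v *)
From mathcomp Require Import all_boot all_order all_algebra.
From mathcomp Require Import complex.
(* The notations of mpoly clash with those of MathComp-Analysis. *)
From mathcomp Require Import (canonicals, coercions) mpoly.
From mathcomp Require Import all_classical all_reals all_analysis.
From mathcomp Require summability.
From Stdlib Require Import Relation_Operators.

Set Implicit Arguments.
Unset Strict Implicit.
Unset Printing Implicit Defensive.

Import Order.TTheory GRing.Theory Num.Theory.
Import numFieldNormedType.Exports.

Local Open Scope classical_set_scope.
Local Open Scope ring_scope.

Section Tree.
Context {A : countType}.
Implicit Type E : A -> A -> Prop.

(* [E a b] means that (a, b) is an edge. As indegrees are at most one, every
   cycle of the underlying graph is a directed one, so it is enough to exclude
   closed directed walks. Uniqueness of the root is a consequence. *)
Record directed_tree E : Prop := DirectedTree {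
  edge_neq : forall a b, E a b -> a <> b ;
  tree_connected : forall a b, clos_refl_sym_trans A E a b ;
  tree_acyclic : forall a, ~ clos_trans A E a a ;
  parent_unique : forall a a' b, E a b -> E a' b -> a = a' }.

Definition is_root E (r : A) : Prop := forall a, ~ E a r.

Definition rooted E : Prop := exists r, is_root E r.

Definition leafless E : Prop := forall v, exists u, E v u.

(* The value at a root, which has no parent, is irrelevant. *)
Definition par E (b : A) : A := xget b [set a | E a b].

Definition Chi E (v : A) : set A := [set u | E v u].

Fixpoint Chin E (n : nat) (v : A) : set A :=
  if n is n'.+1 then \bigcup_(u in Chin E n' v) Chi E u else [set v].

End Tree.

Section WeightedShift.
Context {R : realType} {A : countType}.
Local Notation C := R[i].
Implicit Types (E : A -> A -> Prop) (lam f g : A -> C) (p : R).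
Implicit Types (S G : set (A -> C)) (T : (A -> C) -> (A -> C)).

Definition cmod (z : C) : R := ComplexField.Normc.normc z.

(* lambda(v -> u) for u in Chi^n(v); the vertex v is par^n(u). *)
Definition weight_path E lam (n : nat) (u : A) : C :=
  \prod_(k < n) lam (iter k (par E) u).

(* Sums over the possibly infinite set Chi(v) are limits of finite partial
   sums along the directed set of finite subsets of A. *)
Definition shift_term E lam f (v : A) : A -> C^o :=
  patch (fun=> 0) (Chi E v) (fun u => lam u * f u).

Definition shift_converges E lam f (v : A) : Prop :=
  cvg (summability.partial_sum (shift_term E lam f v) @ summability.totally).

Definition Bshift E lam f : A -> C :=
  fun v => summability.sum (shift_term E lam f v).

Definition lpnorm p f : \bar R :=
  poweR (\esum_(v in [set: A]) ((cmod (f v)) `^ p)%:E) p^-1.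

Definition lp p : set (A -> C) := [set f | (lpnorm p f < +oo)%E].

Definition Bshift_bounded E lam p : Prop :=
  (forall f, lp p f -> forall v, shift_converges E lam f v) /\
  (exists M : R, forall f, lp p f ->
     (lpnorm p (Bshift E lam f) <= M%:E * lpnorm p f)%E).

Definition lp_dense p S : Prop :=
  forall h, lp p h -> forall e : R, 0 < e ->
    exists2 f, S f & (lpnorm p (h - f)%R < e%:E)%E.

Definition HC p T : set (A -> C) :=
  [set x | lp p x /\ lp_dense p (range (fun n => iter n T x))].

(* Products and powers of functions are coordinatewise; subalgebras need not
   contain the constant function 1, which is not in l^p for infinite A. *)
Record lp_subalgebra p S : Prop := LpSubalgebra {
  subalgebra_lp : S `<=` lp p ;
  subalgebra0 : S 0 ;
  subalgebraD : forall f g, S f -> S g -> S (f + g) ;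
  subalgebraZ : forall (c : C) f, S f -> S (fun v => c * f v) ;
  subalgebraM : forall f g, S f -> S g -> S (f * g) }.

Definition hypercyclic_algebra p T S : Prop :=
  [/\ lp_subalgebra p S, S <> [set 0] & S `<=` HC p T `|` [set 0]].

(* P(g_1, ..., g_d) for a polynomial P without constant term; its value at a
   vertex is that of P, since the operations are coordinatewise. *)
Definition mpoly_fun (d : nat) (P : mpoly.mpoly d C) (g : 'I_d -> A -> C) :
    A -> C :=
  fun v => mpoly.meval (fun i => g i v) P.

Definition alg_independent G : Prop :=
  forall (d : nat) (g : 'I_d -> A -> C) (P : mpoly.mpoly d C),
    (0 < d)%N -> injective g -> (forall i, G (g i)) ->
    P != 0 -> mpoly.mcoeff mpoly.mnm0 P = 0 ->
    mpoly_fun P g <> 0.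

Definition countably_generated_free p S : Prop :=
  exists G, [/\ (G #= [set: nat])%card, alg_independent G &
    S = smallest (lp_subalgebra p) G].

End WeightedShift.

(* Main.v *)
Require Import Defs.
From mathcomp Require Import all_boot all_order all_algebra.
From mathcomp Require Import complex.
From mathcomp Require Import (canonicals, coercions) mpoly.
From mathcomp Require Import all_classical all_reals all_analysis.
From mathcomp Require summability.
From mathcomp Require Import finmap.
From mathcomp Require Import ring lra.
From Stdlib Require Import Relation_Operators.

Set Implicit Arguments.
Unset Strict Implicit.
Unset Printing Implicit Defensive.

Import Order.TTheory GRing.Theory Num.Theory.
Import numFieldNormedType.Exports.

Local Open Scope classical_set_scope.
Local Open Scope ring_scope.

(** The theorem is a cycle of implications, of which the first two are easy: a
    dense free hypercyclic algebra is a hypercyclic algebra, and the positive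
    powers of a nonzero element of a hypercyclic algebra are hypercyclic.

    Write [w(v -> u)] for the weight of the path from [v] to a descendant [u] of
    the n-th generation. The n-th iterate of the shift maps the indicator
    function of [u] to [w(v -> u)] times that of [v] ([iter_shift_delta]), so
    [iter n B g v] is the sum of the [w(v -> u) * g u]. If [p <= m] and [f] is
    p-summable, then [g = f ^+ m] has a finite sum [S], and this value is at
    most [S] times the largest weight. If [g] is hypercyclic, some iterate is as
    large as desired on a given finite set of vertices, so the weights are
    ([cvg_of_hypercyclic_power]).

    Conversely, suppose that the weights grow. In a rooted tree a function that
    vanishes from level [n] on is killed by the n-th iterate, so initial
    segments of a function do not matter ([iter_shift_eq_above]). To reach a
    target [g] with the polynomial [c * x ^+ m + O(x ^+ m.+1)], choose [n] and,
    for each [v] in the finite support of [g], a vertex [u] with a large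
    [w(v -> u)], and give the function at [u] the value [x] with
    [c * x ^+ m * w(v -> u) = g v]. This [x] is tiny, so the terms of higher
    order are negligible, uniformly over all polynomials of the same order with
    bounded coefficients; after dividing by [c], countably many choices of
    the order, of the bound and of the target deal with all polynomials and all
    targets ([exists_block]). Such blocks are placed on disjoint ranges of
    levels, each so small that it does not disturb the iterates used for the
    previous ones ([exists_blocks], [glued_orbit]).

    Polynomials in several variables reduce to one variable: if the values of
    the generators on a block are [x ^+ (N ^ i)], with [N] larger than all the
    exponents that occur, distinct monomials become distinct powers of [x]
    ([kronecker_expansion]). So a single sequence of generators, which start
    with arbitrary finitely supported functions and hence can be made dense up
    to scalars, has the property that every nonzero polynomial without constant
    term takes a value with a dense orbit at them ([exists_dense_orbits]). Such
    a value is not zero, so the generators are independent, and the algebra that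
    they generate is hypercyclic ([generated_algebra_hypercyclic]). *)

(** * The modulus of a complex number *)

(* The modulus is a square root of a sum of squares: it should not unfold. *)
#[local] Arguments cmod : simpl never.

Section Modulus.
Context {R : realType}.
Implicit Types x y z : R[i].

Lemma normE z : `|z| = (cmod z)%:C%C.
Proof. by []. Qed.

Lemma cmod_ge0 z : 0 <= cmod z.
Proof. by rewrite -ler0c -normE. Qed.

Lemma cmod0 : cmod (0 : R[i]) = 0.
Proof. exact: ComplexField.Normc.normc0. Qed.

Lemma cmod1 : cmod (1 : R[i]) = 1.
Proof. exact: ComplexField.Normc.normc1. Qed.

Lemma cmodM x y : cmod (x * y) = cmod x * cmod y.
Proof. exact: ComplexField.Normc.normcM. Qed.

Lemma cmodV z : cmod z^-1 = (cmod z)^-1.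
Proof. exact: ComplexField.Normc.normcV. Qed.

Lemma cmod_eq0 z : (cmod z == 0) = (z == 0).
Proof.
by apply/eqP/eqP => [/ComplexField.Normc.eq0_normc//|->]; exact: cmod0.
Qed.

Lemma cmod_gt0 z : (0 < cmod z) = (z != 0).
Proof. by rewrite lt_def cmod_eq0 cmod_ge0 andbT. Qed.

Lemma cmodD x y : cmod (x + y) <= cmod x + cmod y.
Proof. by rewrite -lecR rmorphD /= -!normE; exact: ler_normD. Qed.

Lemma cmodN z : cmod (- z) = cmod z.
Proof. by apply: (@complexI R); rewrite -!normE normrN. Qed.

Lemma cmodX z n : cmod (z ^+ n) = cmod z ^+ n.
Proof.
by elim: n => [|n IHn]; rewrite ?expr0 ?cmod1// !exprS cmodM IHn.
Qed.

Lemma cmod_real (x : R) : cmod x%:C%C = `|x|.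
Proof. by rewrite /cmod /= expr0n addr0 sqrtr_sqr. Qed.

Lemma cmod_nat n : cmod (n%:R : R[i]) = n%:R.
Proof.
by rewrite -(rmorph_nat (real_complex R)) cmod_real ger0_norm// ler0n.
Qed.

Lemma cmod_sum (I : Type) (s : seq I) (P : pred I) (F : I -> R[i]) :
  cmod (\sum_(i <- s | P i) F i) <= \sum_(i <- s | P i) cmod (F i).
Proof.
elim/big_ind2: _ => [|x a y b xa yb|//]; first by rewrite cmod0.
exact: le_trans (cmodD _ _) (lerD xa yb).
Qed.

End Modulus.

(** * The spaces of p-summable functions on a countable set *)

Section Lp.
Context {R : realType} {A : countType}.
Implicit Types (f g h : A -> R[i]) (p : R).

Definition power_sum p f : \bar R :=
  (\esum_(v in [set: A]) ((cmod (f v)) `^ p)%:E)%E.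

Lemma lpnormE p f : lpnorm p f = poweR (power_sum p f) p^-1.
Proof. by []. Qed.

Lemma power_sum_ge0 p f : (0 <= power_sum p f)%E.
Proof. by apply: esum_ge0 => v _; rewrite lee_fin powR_ge0. Qed.

Lemma lpnorm_ge0 p f : (0 <= lpnorm p f)%E.
Proof. exact: poweR_ge0. Qed.

Lemma power_sum_lpnorm p f : 0 < p -> poweR (lpnorm p f) p = power_sum p f.
Proof.
by move=> p0; rewrite lpnormE -poweRrM mulVf ?gt_eqF// poweRe1// power_sum_ge0.
Qed.

Lemma lpnorm_fin p f : lp p f -> lpnorm p f \is a fin_num.
Proof. by move=> fp; rewrite ge0_fin_numE// lpnorm_ge0. Qed.

Lemma lpnorm_fineK p f : lp p f -> ((fine (lpnorm p f))%:E = lpnorm p f)%E.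
Proof. by move=> fp; rewrite fineK// lpnorm_fin. Qed.

Lemma fine_lpnorm_ge0 p f : 0 <= fine (lpnorm p f).
Proof. by rewrite fine_ge0// lpnorm_ge0. Qed.

Lemma le_lpnorm p f g : 0 < p -> (forall v, cmod (f v) <= cmod (g v)) ->
  (lpnorm p f <= lpnorm p g)%E.
Proof.
move=> p0 fg; apply: gt0_ler_poweR.
- by rewrite invr_ge0 ltW.
- by rewrite in_itv/= leey power_sum_ge0.
- by rewrite in_itv/= leey power_sum_ge0.
apply: le_esum => v _.
by rewrite lee_fin ge0_ler_powR ?(ltW p0) ?nnegrE ?cmod_ge0.
Qed.

Lemma le_lp p f g : 0 < p -> (forall v, cmod (f v) <= cmod (g v)) ->
  lp p g -> lp p f.
Proof. by move=> p0 /(le_lpnorm p0)/le_lt_trans fg; exact: fg. Qed.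

Lemma lpnorm_le p f (c : R) : 0 < p -> 0 <= c ->
  (power_sum p f <= (c `^ p)%:E)%E -> (lpnorm p f <= c%:E)%E.
Proof.
move=> p0 c0 fc.
rewrite -[leRHS](@poweRe1 _ c%:E)// -(mulfV (lt0r_neq0 p0)) poweRrM poweR_EFin.
apply: gt0_ler_poweR => //; first by rewrite invr_ge0 ltW.
  by rewrite in_itv/= leey power_sum_ge0.
by rewrite in_itv/= leey lee_fin powR_ge0.
Qed.

Lemma power_sum_fine p f : 0 < p -> lp p f ->
  power_sum p f = ((fine (lpnorm p f)) `^ p)%:E.
Proof.
by move=> p0 fp; rewrite -power_sum_lpnorm// -{1}(lpnorm_fineK fp) poweR_EFin.
Qed.

Lemma esum_mulr (I : set A) (c : R) (F : A -> R) : 0 <= c ->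
  (forall v, 0 <= F v) ->
  (\esum_(v in I) (c * F v)%:E = c%:E * \esum_(v in I) (F v)%:E)%E.
Proof.
move=> c0 F0; have [->|cn0] := eqVneq c 0.
  by rewrite mul0e esum1// => v _; rewrite mul0r.
have cgt0 : (0 < c)%R by rewrite lt_def cn0.
have half (d : R) (G : A -> R) : (0 < d)%R -> (forall v, 0 <= G v)%R ->
    (\esum_(v in I) (d * G v)%:E <= d%:E * \esum_(v in I) (G v)%:E)%E.
  move=> d0 G0; apply: ge_ereal_sup => _ [X [finX XI] <-].
  under eq_fsbigr do rewrite EFinM.
  rewrite fsbig_finite//= -ge0_sume_distrr; last by move=> i _; rewrite lee_fin.
  rewrite lee_pmul2l ?lte_fin// esum_ge//; exists X => //.
  by rewrite fsbig_finite.
apply/eqP; rewrite eq_le half//=.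
rewrite -(@lee_pmul2l _ c^-1%:E) ?lte_fin ?invr_gt0//.
rewrite muleA -EFinM mulVf// mul1e.
rewrite (_ : esum I (fun v => (F v)%:E) =
             esum I (fun v => (c^-1 * (c * F v))%:E)).
  by apply: half; [rewrite invr_gt0|move=> v; rewrite mulr_ge0].
by apply: eq_esum => v _; rewrite mulrA mulVf// mul1r.
Qed.

Lemma lpnormZ p (c : R[i]) f : 0 < p ->
  (lpnorm p (fun v => c * f v)%R = (cmod c)%:E * lpnorm p f)%E.
Proof.
move=> p0; rewrite !lpnormE.
have -> : power_sum p (fun v => c * f v) =
    (((cmod c) `^ p)%:E * power_sum p f)%E.
  rewrite -esum_mulr ?powR_ge0//; last by move=> v; exact: powR_ge0.
  by apply: eq_esum => v _; rewrite cmodM powRM// cmod_ge0.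
rewrite poweRM; [|by rewrite lee_fin powR_ge0|exact: power_sum_ge0].
by rewrite poweR_EFin -powRrM mulfV ?gt_eqF// powRr1// cmod_ge0.
Qed.

Lemma lpZ p (c : R[i]) f : 0 < p -> lp p f -> lp p (fun v => c * f v).
Proof.
move=> p0 fp; rewrite /lp/= lpnormZ// -lpnorm_fineK//.
by rewrite -EFinM ltry.
Qed.

Lemma lpnormN p f : lpnorm p (- f) = lpnorm p f.
Proof.
by congr poweR; apply: eq_esum => v _; rewrite -[(- f) v]/(- f v) cmodN.
Qed.

Lemma lpnorm0 p : 0 < p -> lpnorm p (0 : A -> R[i]) = 0.
Proof.
move=> p0; apply/eqP; rewrite eq_le lpnorm_ge0 andbT.
apply: lpnorm_le => //; rewrite /power_sum esum1 ?lee_fin ?powR_ge0// => v _.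
by rewrite -[(0 : A -> R[i]) v]/0 cmod0 powR0// gt_eqF.
Qed.

Lemma lp0 p : 0 < p -> lp p (0 : A -> R[i]).
Proof. by move=> p0; rewrite /lp/= lpnorm0. Qed.

Lemma le_cmod_lpnorm p f v : 0 < p -> ((cmod (f v))%:E <= lpnorm p f)%E.
Proof.
move=> p0; rewrite -[leLHS](@poweRe1 _ _)// ?lee_fin ?cmod_ge0//.
rewrite -(mulfV (lt0r_neq0 p0)) poweRrM poweR_EFin.
apply: gt0_ler_poweR => //; first by rewrite invr_ge0 ltW.
- by rewrite in_itv/= leey lee_fin powR_ge0.
- by rewrite in_itv/= leey power_sum_ge0.
rewrite /power_sum esum_ge//; exists [set v]; first by split.
by rewrite fsbig_set1.
Qed.

Lemma lp_bounded p f : 0 < p -> lp p f ->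
  forall v, cmod (f v) <= fine (lpnorm p f).
Proof. by move=> p0 fp v; rewrite -lee_fin lpnorm_fineK// le_cmod_lpnorm. Qed.

Lemma powR_convex p (w x y : R) : 1 <= p -> 0 <= w -> w <= 1 ->
  0 <= x -> 0 <= y ->
  (w * x + (1 - w) * y) `^ p <= w * x `^ p + (1 - w) * y `^ p.
Proof.
move=> p1 w0 w1 x0 y0.
have nonneg (z : R) : 0 <= z -> z \in `[0, +oo[%classic.
  by move=> z0; rewrite in_setE/= in_itv/= z0.
have := convex_powR p1 (Itv01 w0 w1) (nonneg _ x0) (nonneg _ y0).
by rewrite !convRE.
Qed.

(** Minkowski's inequality: [cmod f + cmod g] is a multiple of a convex
    combination of [cmod f] and [cmod g], both divided by their norms, and the
    p-th power is convex. *)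
Lemma lpnormD p f g : 1 <= p ->
  (lpnorm p (f + g)%R <= lpnorm p f + lpnorm p g)%E.
Proof.
move=> p1; have p0 : 0 < p by rewrite (lt_le_trans _ p1).
have [fp|] := boolP (lpnorm p f < +oo)%E; last first.
  by rewrite -leNgt leye_eq => /eqP ->; rewrite addye ?leey//
    -ltNye (lt_le_trans _ (lpnorm_ge0 _ _)).
have [gp|] := boolP (lpnorm p g < +oo)%E; last first.
  by rewrite -leNgt leye_eq => /eqP ->; rewrite addey ?leey//
    -ltNye (lt_le_trans _ (lpnorm_ge0 _ _)).
set a := fine (lpnorm p f); set b := fine (lpnorm p g).
have a0 : 0 <= a := fine_lpnorm_ge0 p f.
have b0 : 0 <= b := fine_lpnorm_ge0 p g.
rewrite -(lpnorm_fineK fp) -(lpnorm_fineK gp) -EFinD -/a -/b.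
(* If one of the norms is zero, that function vanishes everywhere. *)
have zero h k : lp p h -> fine (lpnorm p h) = 0 ->
    forall v, cmod ((h + k) v) <= cmod (k v).
  move=> hp h0 v; have := lp_bounded p0 hp v; rewrite h0 => hv.
  by apply: le_trans (cmodD _ _) _; rewrite -lerBrDr subrr.
have [a_eq0|an0] := eqVneq a 0.
  rewrite a_eq0 add0r lpnorm_fineK//.
  exact: le_lpnorm (zero _ _ fp a_eq0).
have [b_eq0|bn0] := eqVneq b 0.
  rewrite b_eq0 addr0 lpnorm_fineK//.
  by rewrite addrC; apply: le_lpnorm (zero _ _ gp b_eq0).
have agt0 : 0 < a by rewrite lt_def an0.
have bgt0 : 0 < b by rewrite lt_def bn0.
have ab0 : 0 < a + b by rewrite addr_gt0.
apply: lpnorm_le => //; first exact: ltW.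
pose w := a / (a + b).
have w0 : 0 <= w by rewrite divr_ge0// ltW.
have w1 : w <= 1 by rewrite ler_pdivrMr// mul1r lerDl.
have wE : 1 - w = b / (a + b).
  by rewrite /w; field; rewrite gt_eqF.
have convex v : (cmod ((f + g) v)) `^ p <= (a + b) `^ p *
    (w * (a^-1 `^ p * (cmod (f v)) `^ p) +
     (1 - w) * (b^-1 `^ p * (cmod (g v)) `^ p)).
  have x0 : 0 <= a^-1 * cmod (f v) by rewrite mulr_ge0 ?invr_ge0 ?cmod_ge0.
  have y0 : 0 <= b^-1 * cmod (g v) by rewrite mulr_ge0 ?invr_ge0 ?cmod_ge0.
  have := powR_convex p1 w0 w1 x0 y0.
  rewrite !powRM ?invr_ge0 ?cmod_ge0// => le_conv.
  apply: (le_trans _ (ler_wpM2l (powR_ge0 _ _) le_conv)).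
  have z0 : 0 <= w * (a^-1 * cmod (f v)) + (1 - w) * (b^-1 * cmod (g v)).
    by rewrite addr_ge0// mulr_ge0// subr_ge0.
  rewrite -powRM ?(ltW ab0)//; apply: ge0_ler_powR; rewrite ?(ltW p0)//.
  - by rewrite nnegrE cmod_ge0.
  - by rewrite nnegrE mulr_ge0// ltW.
  rewrite (_ : _ * _ = cmod (f v) + cmod (g v)); first exact: cmodD.
  by rewrite wE /w; field; rewrite (gt_eqF ab0) an0 bn0.
apply: (@le_trans _ _ (\esum_(v in [set: A]) ((a + b) `^ p *
    (w * (a^-1 `^ p * (cmod (f v)) `^ p) +
     (1 - w) * (b^-1 `^ p * (cmod (g v)) `^ p)))%:E)%E).
  by apply: le_esum => v _; rewrite lee_fin.
have term0 (c d : R) h v : 0 <= c -> 0 <= c * (d `^ p * cmod (h v) `^ p).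
  by move=> c0; rewrite !mulr_ge0 ?powR_ge0.
have w'0 : 0 <= 1 - w by rewrite subr_ge0.
rewrite esum_mulr ?powR_ge0//; last by move=> v; rewrite addr_ge0 ?term0.
under eq_esum do rewrite EFinD.
rewrite esumD; [|by move=> v _; rewrite lee_fin term0..].
rewrite !esum_mulr ?powR_ge0//; do ?by move=> v; rewrite ?mulr_ge0 ?powR_ge0.
rewrite -/(power_sum p f) -/(power_sum p g) !power_sum_fine// -/a -/b -!EFinM.
have cancel (c : R) : 0 < c -> c^-1 `^ p * c `^ p = 1.
  move=> c0; rewrite -powRM ?invr_ge0 ?(ltW c0)// mulVf ?gt_eqF//.
  by rewrite powR1.
clearbody w; clearbody a b; rewrite !cancel// !mulr1.
by rewrite (addrC w) subrK mulr1 lexx.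
Qed.

Lemma lpD p f g : 1 <= p -> lp p f -> lp p g -> lp p (f + g).
Proof.
move=> p1 fp gp; apply: le_lt_trans (lpnormD f g p1) _.
by rewrite -(lpnorm_fineK fp) -(lpnorm_fineK gp) -EFinD ltry.
Qed.

Lemma lpM p f g : 0 < p -> lp p f -> lp p g -> lp p (f * g).
Proof.
move=> p0 fp gp; pose c := fine (lpnorm p f).
apply: (@le_lp _ _ (fun v => c%:C%C * g v)) => //; last exact: lpZ.
move=> v; rewrite !cmodM cmod_real ler_wpM2r ?cmod_ge0// ger0_norm.
  exact: lp_bounded.
exact: fine_lpnorm_ge0.
Qed.

(** A function of sum [S] is bounded by [S], so that the p-th powers of its
    values are at most [S `^ (p - 1)] times the values. *)
Lemma lpnorm_le_esum p f : 1 <= p ->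
  (lpnorm p f <= \esum_(v in [set: A]) (cmod (f v))%:E)%E.
Proof.
move=> p1; have p0 : 0 < p by rewrite (lt_le_trans _ p1).
set S := esum _ _.
have S0 : (0 <= S)%E by apply: esum_ge0 => v _; rewrite lee_fin cmod_ge0.
have [->|Sfin] := eqVneq S +oo%E; first exact: leey.
have {}Sfin : S \is a fin_num by rewrite ge0_fin_numE// ltey.
rewrite -(fineK Sfin); apply: lpnorm_le; rewrite ?fine_ge0//.
have fS v : cmod (f v) <= fine S.
  rewrite -lee_fin fineK//; apply: esum_ge; exists [set v]; first by split.
  by rewrite fsbig_set1.
apply: (@le_trans _ _
    (\esum_(v in [set: A]) (fine S `^ (p - 1) * cmod (f v))%:E)%E).
  apply: le_esum => v _; rewrite lee_fin -mulr_powRB1 ?cmod_ge0// mulrC.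
  rewrite ler_wpM2r ?cmod_ge0//; apply: ge0_ler_powR; rewrite ?subr_ge0//.
    by rewrite nnegrE cmod_ge0.
  by rewrite nnegrE fine_ge0.
rewrite esum_mulr ?powR_ge0//; last by move=> v; exact: cmod_ge0.
by rewrite -/S -{2}(fineK Sfin) -EFinM mulrC mulr_powRB1// fine_ge0.
Qed.

Lemma lp_of_esum p f : 1 <= p ->
  (\esum_(v in [set: A]) (cmod (f v))%:E < +oo)%E -> lp p f.
Proof. by move=> p1; exact: le_lt_trans (lpnorm_le_esum f p1). Qed.

End Lp.

(** * Finitely supported functions *)

Section FiniteSupport.
Context {R : realType} {A : countType}.
Implicit Types (f g h : A -> R[i]) (p : R) (s : seq A).

Lemma esum_support s (F : A -> R) : uniq s -> (forall v, 0 <= F v) ->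
  (forall v, v \notin s -> F v = 0) ->
  (\esum_(v in [set: A]) (F v)%:E = (\sum_(v <- s) F v)%:E)%E.
Proof.
move=> us F0 Fs.
transitivity (\esum_(v in [set` s]) (F v)%:E)%E.
  rewrite [RHS]esum_mkcond; apply: eq_esum => v _.
  by rewrite mem_setE; case: ifPn => // /Fs ->.
rewrite esum_fset; [|exact: finite_seq|by move=> v _; rewrite lee_fin].
by rewrite -fsbig_seq// sumEFin.
Qed.

Definition delta (u : A) : A -> R[i] := fun v => (v == u)%:R.

Lemma esum_delta u : (\esum_(v in [set: A]) (cmod (delta u v))%:E = 1)%E.
Proof.
rewrite (@esum_support [:: u])//.
- by rewrite big_seq1 /delta eqxx cmod1.
- by move=> v; exact: cmod_ge0.
- by move=> v; rewrite inE /delta => /negbTE ->; rewrite cmod0.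
Qed.

Lemma lpnorm_delta p u : 1 <= p -> (lpnorm p (delta u) <= 1)%E.
Proof.
by move=> p1; apply: le_trans (lpnorm_le_esum _ p1) _; rewrite esum_delta.
Qed.

Lemma lp_delta p u : 1 <= p -> lp p (delta u).
Proof. by move=> p1; apply: le_lt_trans (lpnorm_delta u p1) (ltry _). Qed.

Lemma lp_support p s f : 1 <= p -> (forall v, v \notin s -> f v = 0) ->
  lp p f.
Proof.
move=> p1 fs; apply: (lp_of_esum p1).
rewrite (@esum_support (undup s)) ?undup_uniq ?ltry// => v.
  exact: cmod_ge0.
by rewrite mem_undup => /fs ->; rewrite cmod0.
Qed.

(** The finite partial sums approximate the p-norm, so the rest of a
    p-summable function outside a large finite set is small. *)
Lemma lp_tail p h (e : R) : 1 <= p -> lp p h -> 0 < e ->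
  exists s, uniq s /\
    (lpnorm p (fun v => if v \in s then 0 else h v)%R <= e%:E)%E.
Proof.
move=> p1 hp e0; have p0 : 0 < p by rewrite (lt_le_trans _ p1).
have ep0 : 0 < e `^ p by rewrite powR_gt0.
have := power_sum_fine p0 hp; set S := fine _ `^ p => hS.
have : (power_sum p h - (e `^ p)%:E < power_sum p h)%E.
  by rewrite hS -EFinB lte_fin ltrBlDr ltrDl.
move=> /ereal_sup_gt [_ [X [finX _] <-]]; rewrite -/(power_sum p h) => hX.
exists (fset_set X); split; first exact: fset_uniq.
apply: lpnorm_le; rewrite ?(ltW e0)//.
have pos v : (0 <= (cmod (h v) `^ p)%:E)%E by rewrite lee_fin powR_ge0.
have hsplit : power_sum p h = (\sum_(v \in X) (cmod (h v) `^ p)%:E +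
    power_sum p (fun v => if v \in fset_set X then 0 else h v)%R)%E.
  rewrite {1}/power_sum (esumID X)//; congr (_ + _)%E.
    by rewrite setTI esum_fset.
  rewrite setTI esum_mkcond; apply: eq_esum => v _.
  rewrite in_setC in_fset_set//; case: (v \in X) => //=.
  by rewrite cmod0 powR0// gt_eqF.
move: hX; rewrite [in X in (X < _)%E]hsplit.
have Xfin : (\sum_(v \in X) (cmod (h v) `^ p)%:E)%E \is a fin_num.
  by rewrite fsbig_finite//= sumEFin.
rewrite -(fineK Xfin).
have := hsplit; rewrite hS -{1}(fineK Xfin).
case: (power_sum p _) => [r| |]//.
by rewrite -EFinN -!EFinD lte_fin lee_fin => _; lra.
Qed.

(** There are countably many codes, and the functions that they describe, with
    finite support and values in [Q + i Q], are dense. So the construction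
    below can enumerate its targets. *)
Definition code : Type := seq (A * (rat * rat)).

Definition gauss (q : rat * rat) : R[i] := (ratr q.1 +i* ratr q.2)%C.

Definition code_fun (c : code) : A -> R[i] :=
  fun v => \sum_(x <- c | x.1 == v) gauss x.2.

Lemma code_fun_support (c : code) v : v \notin [seq x.1 | x <- c] ->
  code_fun c v = 0.
Proof.
move=> vc; rewrite /code_fun big_seq_cond big1// => x /andP[xc /eqP xv].
by move: vc; rewrite -xv map_f.
Qed.

Lemma gauss_dense (z : R[i]) (e : R) : 0 < e ->
  exists q, cmod (z - gauss q) < e.
Proof.
move=> e0; case: z => x y.
have approx (t : R) : exists q : rat, `|t - ratr q| < e / 2.
  have [|q] := @rat_in_itvoo R (t - e / 2) (t + e / 2).
    by rewrite ltrD2l; lra.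
  by rewrite in_itv/= => /andP[q1 q2]; exists q; rewrite ltr_norml; lra.
have [[q1 xq1] [q2 yq2]] := (approx x, approx y).
exists (q1, q2).
have -> : (x +i* y)%C - gauss (q1, q2) =
    (x - ratr q1)%:C%C + 'i%C * (y - ratr q2)%:C%C :> R[i].
  by rewrite /gauss/=; simpc.
apply: le_lt_trans (cmodD _ _) _; rewrite cmodM !cmod_real.
have -> : cmod ('i%C : R[i]) = 1.
  by rewrite /cmod/= expr0n/= add0r expr1n sqrtr1.
by rewrite mul1r; lra.
Qed.

Lemma code_dense p h (e : R) : 1 <= p -> lp p h -> 0 < e ->
  exists c : code, (lpnorm p (h - code_fun c)%R < e%:E)%E.
Proof.
move=> p1 hp e0; have [|s [us hs]] := lp_tail p1 hp (e := e / 3).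
  by rewrite divr_gt0.
pose d := e / 3 / (size s).+1%:R.
have d0 : 0 < d by rewrite !divr_gt0.
have [q hq] := choice (fun v => gauss_dense (h v) d0).
exists [seq (v, q v) | v <- s].
have codeE v : code_fun [seq (v, q v) | v <- s] v =
    if v \in s then gauss (q v) else 0.
  rewrite /code_fun big_map/=; case: ifPn => vs.
    by rewrite -big_filter filter_pred1_uniq// big_seq1.
  by rewrite big_seq_cond big1// => x /andP[xs /eqP xv]; rewrite -xv xs in vs.
pose f2 v := if v \in s then h v - gauss (q v) else 0.
have -> : h - code_fun [seq (v, q v) | v <- s] =
    (fun v => if v \in s then 0 else h v) + f2.
  apply/funext => v; rewrite -[LHS]/(h v - code_fun _ v) codeE.
  rewrite -[RHS]/((if v \in s then 0 else h v) + f2 v) /f2.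
  by case: ifPn => _; rewrite ?add0r ?addr0 ?subr0.
apply: le_lt_trans (lpnormD _ _ p1) _.
apply: (@le_lt_trans _ _ ((e / 3)%:E + (e / 3)%:E)%E); last first.
  by rewrite -EFinD lte_fin; lra.
apply: leeD; first exact: hs.
apply: le_trans (lpnorm_le_esum _ p1) _.
rewrite (esum_support us); first last.
- by move=> v /negbTE vs; rewrite /f2 vs cmod0.
- by move=> v; exact: cmod_ge0.
rewrite lee_fin; apply: (@le_trans _ _ (\sum_(v <- s) d)).
  rewrite big_seq [leRHS]big_seq; apply: ler_sum => v vs.
  by rewrite /f2 vs ltW.
rewrite big_const_seq count_predT iter_addr_0 -[d *+ _]mulr_natr.
apply: (@le_trans _ _ (d * (size s).+1%:R)).
  by rewrite ler_wpM2l ?ler_nat// ltW.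
by rewrite /d divfK// pnatr_eq0.
Qed.

End FiniteSupport.

(** * Polynomials along Kronecker curves *)

Section Kronecker.
Context {R : realType}.
Local Notation C := R[i].

Lemma base_expansion_inj N d (a b : 'I_d -> nat) :
  (forall i, (a i < N)%N) -> (forall i, (b i < N)%N) ->
  (\sum_(i < d) a i * N ^ i = \sum_(i < d) b i * N ^ i)%N -> a =1 b.
Proof.
elim: d a b => [|d IHd] a b aN bN; first by move=> _ [].
have step (c : 'I_d.+1 -> nat) : (\sum_(i < d.+1) c i * N ^ i =
    (\sum_(i < d) c (lift ord0 i) * N ^ i) * N + c ord0)%N.
  rewrite big_ord_recl /= expn0 muln1 addnC big_distrl/=; congr (_ + _)%N.
  by apply: eq_bigr => i _; rewrite /bump leq0n add1n expnSr mulnA.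
rewrite !step => ab.
have N0 : (0 < N)%N by rewrite (leq_ltn_trans _ (aN ord0)).
have low : a ord0 = b ord0.
  by have := congr1 (modn^~ N) ab; rewrite /= !modnMDl !modn_small.
have high := congr1 (divn^~ N) ab.
rewrite /= !divnMDl// !divn_small// !addn0 in high.
move=> i; case: (unliftP ord0 i) => [j|] -> //.
exact: (IHd (fun j => a (lift ord0 j)) (fun j => b (lift ord0 j))
  (fun=> aN _) (fun=> bN _) high j).
Qed.

Lemma meval_zero d (P : mpoly.mpoly d C) :
  mpoly.meval (fun=> 0) P = mpoly.mcoeff mpoly.mnm0 P.
Proof.
rewrite mpoly.mevalE [RHS](_ : _ =
  \sum_(m <- mpoly.msupp P | m == mpoly.mnm0) mpoly.mcoeff m P); last first.
  rewrite -big_filter; have [P0|P0] := boolP (mpoly.mnm0 \in mpoly.msupp P).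
    by rewrite filter_pred1_uniq ?mpoly.msupp_uniq// big_seq1.
  rewrite (_ : seq.filter _ _ = [::]) ?big_nil.
    exact: mpoly.memN_msupp_eq0.
  apply/eqP; rewrite -(negbK (_ == _)) -has_filter; apply/hasPn => m mP.
  by apply: contraNneq P0 => <-.
rewrite [RHS]big_mkcond; apply: eq_bigr => m _.
case: eqP => [->|/eqP m0].
  by rewrite big1 ?mulr1// => i _; rewrite mpoly.mnm0E expr0.
rewrite -mpoly.mdeg_eq0 mpoly.mdegE sum_nat_eq0 in m0.
move/forallPn : m0 => [i mi]; rewrite (bigD1 i)//= expr0n.
by rewrite -[(_ == _)]negbK mi mul0r mulr0.
Qed.

(** Along the curve [t |-> (t ^ (N.+1 ^ i))_i] distinct monomials with
    exponents at most [N] become distinct powers of [t], by uniqueness of the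
    digits in base [N.+1]. The smallest of these powers dominates at 0; it is a
    positive power because there is no constant term. *)
Lemma kronecker_expansion d (P : mpoly.mpoly d C) :
  P != 0 -> mpoly.mcoeff mpoly.mnm0 P = 0 ->
  exists N m (a : C) (r : R), [/\ (d <= N)%N, a != 0, 0 <= r,
    forall (z : 'I_d -> C) (s : R), 0 <= s <= 1 ->
      (forall i, cmod (z i) <= s) -> cmod (mpoly.meval z P) <= r * s &
    forall t : C, cmod t <= 1 ->
      cmod (mpoly.meval (fun i : 'I_d => t ^+ (N.+1 ^ i)) P - a * t ^+ m.+1)
        <= r * cmod t ^+ m.+2].
Proof.
move=> P0 Pc; pose S := mpoly.msupp P; pose c mo := mpoly.mcoeff mo P.
pose N0 := maxn d (mpoly.mmeasure mpoly.mdeg P); pose N := N0.+1.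
have digit mo : mo \in S -> forall i, (mo i < N)%N.
  move=> /mpoly.msize_mdeg_lt moP i; rewrite ltnS leq_max; apply/orP; right.
  apply: leq_trans (ltnW moP); rewrite mpoly.mdegE (bigD1 i)//=.
  exact: leq_addr.
(* The exponent of [t] that the monomial [mo] becomes. *)
pose kappa (mo : mpoly.multinom d) := (\sum_(i < d) mo i * N ^ i)%N.
have kappa_inj : {in S &, injective kappa}.
  move=> m1 m2 /digit h1 /digit h2 h; apply/mpoly.mnmP.
  exact: (base_expansion_inj h1 h2 h).
have nz mo : mo \in S -> exists i, (0 < mo i)%N.
  move=> moS; have : mo != mpoly.mnm0.
    by apply: contraTneq moS => ->; rewrite mpoly.mcoeff_msupp Pc eqxx.
  rewrite -mpoly.mdeg_eq0 mpoly.mdegE sum_nat_eq0 => /forallPn[j].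
  by rewrite /= -lt0n; exists j.
have kappa0 mo : mo \in S -> (0 < kappa mo)%N.
  move=> /nz[i moi]; rewrite /kappa (bigD1 i)//= addn_gt0 muln_gt0 moi.
  by rewrite expn_gt0.
have exK : exists k, has (fun mo => kappa mo == k) S.
  have : S != [::] by rewrite mpoly.msupp_eq0.
  by case: (S) => // mo S' _; exists (kappa mo); rewrite /= eqxx.
case: (ex_minnP exK) => k /hasP[mo0 mo0S /eqP k0] kmin.
have kmin' mo : mo \in S -> (k <= kappa mo)%N.
  by move=> moS; apply: kmin; apply/hasP; exists mo.
pose r := \sum_(mo <- S) cmod (c mo).
have r0 : 0 <= r by apply: sumr_ge0 => mo _; exact: cmod_ge0.
exists N0, k.-1, (c mo0), r; rewrite -/N.
have -> : k.-1.+1 = k by rewrite prednK// -k0 kappa0.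
split=> //; first exact: leq_maxl.
- by rewrite -mpoly.mcoeff_msupp.
- move=> z s /andP[s0 s1] zs; rewrite mpoly.mevalE.
  apply: le_trans (cmod_sum _ _ _) _; rewrite mulr_suml.
  rewrite big_seq [leRHS]big_seq; apply: ler_sum => mo moS.
  rewrite cmodM ler_wpM2l ?cmod_ge0//; have [i moi] := nz mo moS.
  have le1 j : cmod (z j ^+ mo j) <= 1.
    by rewrite cmodX exprn_ile1 ?cmod_ge0// (le_trans (zs j)).
  have prod_le1 (Q : pred 'I_d) : cmod (\prod_(j | Q j) z j ^+ mo j) <= 1.
    elim/big_rec: _ => [|j x _ xle]; first by rewrite cmod1.
    by rewrite cmodM mulr_ile1 ?cmod_ge0.
  rewrite (bigD1 i)//= cmodM -[leRHS]mulr1 ler_pM ?cmod_ge0//.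
  rewrite cmodX; case: (mo i) moi => // q _; rewrite exprS.
  rewrite -[leRHS]mulr1 ler_pM ?cmod_ge0 ?exprn_ge0 ?cmod_ge0//.
  by rewrite exprn_ile1 ?cmod_ge0// (le_trans (zs i)).
move=> t t1; rewrite mpoly.mevalE.
have curve (mo : mpoly.multinom d) :
    \prod_(i < d) (t ^+ (N ^ i)) ^+ mo i = t ^+ kappa mo.
  rewrite /kappa expr_sum; apply: eq_bigr => i _.
  by rewrite -exprM mulnC.
rewrite (bigD1_seq mo0) ?mpoly.msupp_uniq//= curve k0 addrAC subrr add0r.
apply: le_trans (cmod_sum _ _ _) _.
rewrite mulr_suml [leRHS](bigD1_seq mo0) ?mpoly.msupp_uniq//=.
rewrite ler_wpDl ?mulr_ge0 ?cmod_ge0 ?exprn_ge0 ?cmod_ge0//.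
rewrite big_seq_cond [leRHS]big_seq_cond; apply: ler_sum => mo /andP[moS mo0'].
rewrite cmodM curve ler_wpM2l ?cmod_ge0// cmodX.
apply: ler_wiXn2l; rewrite ?cmod_ge0//.
rewrite ltn_neqAle kmin'// andbT; apply: contraNneq mo0' => kk.
by apply/eqP; apply: kappa_inj => //; rewrite -kk.
Qed.

(** This gives two polynomials the same variables, and moves an arbitrary
    finite family of generators into an initial segment of their enumeration.
    An injective renaming is undone by a substitution, so it does not kill a
    nonzero polynomial. *)
Lemma mpoly_rename d D (sg : 'I_d -> 'I_D) (P : mpoly.mpoly d C) :
  exists Q : mpoly.mpoly D C,
    (forall v, mpoly.meval v Q = mpoly.meval (v \o sg) P) /\
    (injective sg -> P != 0 -> Q != 0).
Proof.
exists (mpoly.comp_mpoly [tuple mpoly.mpolyX C (mpoly.mnm1 (sg i)) | i < d] P).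
split=> [v|sg_inj P0].
  rewrite mpoly.comp_mpoly_meval; apply: mpoly.meval_eq => i.
  by rewrite tnth_mktuple mpoly.mevalXU.
pose tau j : mpoly.mpoly d C :=
  if [pick i | sg i == j] is Some i then mpoly.mpolyX C (mpoly.mnm1 i) else 0.
have tau_sg i : tau (sg i) = mpoly.mpolyX C (mpoly.mnm1 i).
  rewrite /tau; case: pickP => [i' /eqP/sg_inj ->//|/(_ i)].
  by rewrite eqxx.
apply: contraNneq P0 => Q0.
have : mpoly.comp_mpoly [tuple tau j | j < D] (mpoly.comp_mpoly
    [tuple mpoly.mpolyX C (mpoly.mnm1 (sg i)) | i < d] P) = P.
  rewrite (mpoly.comp_mpolyE P) raddf_sum/= [RHS]mpoly.mpolyE.
  apply: eq_bigr => mo _; rewrite mpoly.comp_mpolyZ; congr (_ *: _).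
  rewrite rmorph_prod/= mpoly.mpolyXE_id; apply: eq_bigr => i _.
  rewrite rmorphXn/= tnth_mktuple mpoly.comp_mpolyXU.
  by rewrite -tnth_nth tnth_mktuple tau_sg.
by rewrite Q0 mpoly.comp_mpoly0 => <-.
Qed.

End Kronecker.

(** * Sums over finite subsets *)

Section Summation.
Context {R : realType} {A : countType}.
Implicit Types (x y : A -> R[i]^o) (s : seq A).

Notation psums x :=
  (summability.partial_sum x @ @summability.totally A).

#[local] Instance totally_proper : ProperFilter (@summability.totally A) :=
  summability.totally_filter.

Lemma cvg_sum_support s x : uniq s -> (forall v, v \notin s -> x v = 0) ->
  psums x --> (\sum_(v <- s) x v : R[i]^o).
Proof.
move=> us xs; apply: cvg_near_cst.
exists [fset v | v in s]%fset => // J /= sJ.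
rewrite /summability.partial_sum -(big_seq_fsetE _ J xpredT x)/=.
rewrite [LHS](bigID (mem s))/= [X in _ + X]big1 ?addr0; last first.
  by move=> v; exact: xs.
rewrite -big_filter; apply: perm_big; apply: uniq_perm => //.
  by rewrite filter_uniq// fset_uniq.
move=> v; rewrite mem_filter; case vs : (v \in s) => //=.
by apply: (fsubsetP sJ); rewrite inE.
Qed.

Lemma sum_support s x : uniq s -> (forall v, v \notin s -> x v = 0) ->
  summability.sum x = \sum_(v <- s) x v.
Proof. move=> us xs; apply: (cvg_lim (@norm_hausdorff R[i] R[i]^o)).
exact: cvg_sum_support. Qed.

Lemma sum_linear (a : R[i]) x y : cvg (psums x) -> cvg (psums y) ->
  summability.sum (fun v => a * x v + y v : R[i]^o) =
  a * summability.sum x + summability.sum y.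
Proof.
move=> cx cy; apply: (cvg_lim (@norm_hausdorff R[i] R[i]^o)).
have -> : summability.partial_sum (fun v => a * x v + y v : R[i]^o) =
    (fun J => a *: summability.partial_sum x J + summability.partial_sum y J).
  apply/funext => J; rewrite /summability.partial_sum big_split/=.
  by rewrite -mulr_sumr.
by apply: (@cvgD R[i] R[i]^o); [apply: cvgZr; exact: cx|exact: cy].
Qed.

End Summation.

(** * Directed trees *)

Section Tree.
Context {A : countType} {E : A -> A -> Prop}.
Hypothesis treeE : directed_tree E.
Implicit Types (u v w : A).

Lemma par_edge u v : E v u -> par E u = v.
Proof.
move=> Evu; have h : E (par E u) u.
  exact: (@xgetPex _ u [set a | E a u] (ex_intro _ v Evu)).
exact: (parent_unique treeE h Evu).
Qed.

Lemma Chin_inj n v w u : Chin E n v u -> Chin E n w u -> v = w.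
Proof.
elim: n u => [|n IHn] u; first by move=> -> ->.
move=> [a va au] [b wb bu]; have eab := parent_unique treeE au bu.
by apply: (IHn a) => //; rewrite eab.
Qed.

Lemma Chin_root_inj r n m u : is_root E r ->
  Chin E n r u -> Chin E m r u -> n = m.
Proof.
move=> rootr; elim: n m u => [|n IHn] [|m] u //.
- by move=> -> [a _ /rootr].
- by move=> [a ra au] ur; rewrite ur in au; have := rootr _ au.
move=> [a ra au] [b rb bu]; have eab := parent_unique treeE au bu.
by congr S; apply: (IHn m a) => //; rewrite eab.
Qed.

(** The level of a vertex is its distance to the root. Every vertex has one:
    the set of descendants of the root is closed under passing to children and,
    as parents are unique and the root has none, to parents. *)
Lemma exists_level : rooted E ->
  exists lev : A -> nat, forall a b, E a b -> lev b = (lev a).+1.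
Proof.
move=> [r rootr].
have reach u : exists n, Chin E n r u.
  have step a b : clos_refl_sym_trans A E a b ->
      ((exists n, Chin E n r a) <-> (exists n, Chin E n r b)).
    elim=> {a b} [a b ab|a|a b _ IH|a b c _ IH1 _ IH2].
    - split=> [[n na]|[[|n]]]; first by exists n.+1, a.
      + by move=> br; rewrite br in ab; have := rootr _ ab.
      + move=> [c rc cb]; exists n.
        by rewrite (parent_unique treeE ab cb).
    - by [].
    - by split=> h; apply/IH.
    - by split=> h; [apply/IH2/IH1|apply/IH1/IH2].
  by apply/(step r u (tree_connected treeE r u)); exists 0%N.
have [lev levP] := choice reach.
exists lev => a b ab; apply: (Chin_root_inj rootr (levP b)).
by exists a.
Qed.

Lemma Chin_level (lev : A -> nat) :
  (forall a b, E a b -> lev b = (lev a).+1) ->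
  forall n v u, Chin E n v u -> lev u = (lev v + n)%N.
Proof.
move=> levE; elim=> [|n IHn] v u; first by move=> ->; rewrite addn0.
by move=> [w /IHn vw /levE ->]; rewrite vw addnS.
Qed.

End Tree.

(** * Iterates of the weighted shift *)

Section Shift.
Context {R : realType} {A : countType} {E : A -> A -> Prop}.
Context {lam : A -> R[i]} {p : R}.
Hypothesis treeE : directed_tree E.
Hypothesis p1 : 1 <= p.
Hypothesis boundedB : Bshift_bounded E lam p.
Implicit Types (f g h : A -> R[i]).

Local Notation B := (Bshift E lam).

Let p0 : 0 < p := lt_le_trans ltr01 p1.

(** The bound [M >= 1] makes the bounds [M ^+ n] increase with [n]. *)
Lemma shift_bound : exists2 M : R, 1 <= M &
  forall n f, lp p f ->
    lp p (iter n B f) /\ (lpnorm p (iter n B f) <= (M ^+ n)%:E * lpnorm p f)%E.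
Proof.
have [_ [M0 hM0]] := boundedB; exists (Num.max 1 M0).
  by rewrite le_max lexx.
set M := Num.max 1 M0.
have M_ge0 : 0 <= M by rewrite (@le_trans _ _ 1)// le_max lexx.
have hM f : lp p f -> (lpnorm p (B f) <= M%:E * lpnorm p f)%E.
  move=> fp; apply: le_trans (hM0 f fp) _.
  by rewrite lee_wpmul2r ?lpnorm_ge0// lee_fin le_max lexx orbT.
elim=> [|n IHn] f fp; first by rewrite expr0 mul1e.
have [fnp le_fn] := IHn f fp.
have le_fSn : (lpnorm p (iter n.+1 B f) <= (M ^+ n.+1)%:E * lpnorm p f)%E.
  rewrite iterS; apply: le_trans (hM _ fnp) _.
  by rewrite exprS EFinM -muleA lee_wpmul2l// lee_fin.
split=> //; apply: le_lt_trans le_fSn _.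
by rewrite -(lpnorm_fineK fp) -EFinM ltry.
Qed.

Lemma lp_iter n f : lp p f -> lp p (iter n B f).
Proof. by have [M _ h] := shift_bound => /(h n)[]. Qed.

Lemma shift_linear (a : R[i]) f g : lp p f -> lp p g ->
  B (fun v => a * f v + g v) = (fun v => a * B f v + B g v).
Proof.
move=> fp gp; apply/funext => v; have [cvgB _] := boundedB.
rewrite -(sum_linear a (cvgB f fp v) (cvgB g gp v)) /Bshift.
have -> // : shift_term E lam (fun u => a * f u + g u) v =
    (fun u => a * shift_term E lam f v u + shift_term E lam g v u).
apply/funext => u; rewrite /shift_term /patch.
case: ifP => _; last by rewrite mulr0 addr0.
by rewrite mulrDr mulrCA.
Qed.

Lemma iter_shift_linear n (a : R[i]) f g : lp p f -> lp p g ->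
  iter n B (fun v => a * f v + g v) =
  (fun v => a * iter n B f v + iter n B g v).
Proof.
move=> fp gp; elim: n => [|n IHn]//=.
by rewrite IHn shift_linear; [|exact: lp_iter|exact: lp_iter].
Qed.

Lemma iter_shift0 n : iter n B 0 = 0.
Proof.
elim: n => [|n IHn]//; rewrite iterS IHn; apply/funext => v.
rewrite /Bshift (@sum_support _ _ [::])// ?big_nil// => u _.
by rewrite /shift_term /patch; case: ifP => _ //; exact: mulr0.
Qed.

Lemma iter_shiftD n f g : lp p f -> lp p g ->
  iter n B (f + g) = iter n B f + iter n B g.
Proof.
move=> fp gp; have -> : f + g = (fun v => 1 * f v + g v).
  by apply/funext => v; rewrite mul1r.
by rewrite iter_shift_linear//; apply/funext => v; rewrite mul1r.
Qed.

Lemma iter_shiftZ n (a : R[i]) f : lp p f ->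
  iter n B (fun v => a * f v) = (fun v => a * iter n B f v).
Proof.
move=> fp.
have -> : (fun v => a * f v) = (fun v => a * f v + (0 : A -> R[i]) v).
  by apply/funext => v; rewrite addr0.
rewrite iter_shift_linear//; last exact: lp0.
by rewrite iter_shift0; apply/funext => v; rewrite addr0.
Qed.

Lemma mem_Chi u v : (u \in Chi E v) = `[< E v u >].
Proof. by apply/idP/asboolP; rewrite in_setE. Qed.

Lemma shift_delta u v :
  B (delta u) v = if `[< E v u >] then lam u else 0.
Proof.
rewrite /Bshift (@sum_support _ _ [:: u])//; last first.
  move=> x; rewrite inE => /negbTE xu; rewrite /shift_term /patch /delta xu.
  by rewrite mulr0 if_same.
by rewrite big_seq1 /shift_term /patch /delta eqxx mulr1 mem_Chi.
Qed.

Lemma weight_pathS n w u : E w u ->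
  weight_path E lam n.+1 u = lam u * weight_path E lam n w.
Proof.
move=> wu; rewrite /weight_path big_ord_recl; congr (_ * _).
by apply: eq_bigr => k _; rewrite lift0 iterSr (par_edge treeE wu).
Qed.

Lemma iter_shift_delta n u v :
  iter n B (delta u) v =
  if `[< Chin E n v u >] then weight_path E lam n u else 0.
Proof.
elim: n u => [|n IHn] u.
  rewrite /= /weight_path big_ord0 /delta.
  by case: asboolP => [->|h]; rewrite ?eqxx//; case: eqP => // vu; case: h.
rewrite iterSr; have [[w wu]|nopar] := pselect (exists w, E w u).
  have -> : B (delta u) = (fun x => lam u * delta w x).
    apply/funext => x; rewrite shift_delta /delta.
    case: asboolP => [xu|nxu].
      by rewrite (parent_unique treeE xu wu) eqxx mulr1.
    by case: eqP => [xw|_]; [rewrite xw in nxu|rewrite mulr0].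
  rewrite iter_shiftZ; last exact: lp_delta.
  rewrite IHn (weight_pathS n wu).
  have -> : `[< Chin E n.+1 v u >] = `[< Chin E n v w >].
    apply: asbool_equiv_eq; split=> [[x vx xu]|vw]; last by exists w.
    by rewrite (parent_unique treeE wu xu).
  by case: ifP; rewrite ?mulr0.
have -> : B (delta u) = 0.
  apply/funext => x; rewrite shift_delta; case: asboolP => // xu.
  by case: nopar; exists x.
rewrite iter_shift0; case: asboolP => // -[x _ xu].
by case: nopar; exists x.
Qed.

Lemma iter_shift_support n s f : uniq s -> (forall v, v \notin s -> f v = 0) ->
  forall v, iter n B f v = \sum_(u <- s) f u * iter n B (delta u) v.
Proof.
move=> us fs.
have sumE t : iter n B (fun v => \sum_(u <- t) f u * delta u v) =
    (fun v => \sum_(u <- t) f u * iter n B (delta u) v).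
  elim: t => [|u t IHt].
    under eq_fun do rewrite big_nil.
    by rewrite iter_shift0; apply/funext => v; rewrite big_nil.
  under eq_fun do rewrite big_cons.
  rewrite iter_shift_linear ?IHt; last 2 first.
  - exact: lp_delta.
  - apply: (@lp_support _ _ p t) => // v vt.
    rewrite big_seq big1// => x xt; rewrite /delta.
    by case: eqP => [vx|_]; [rewrite vx xt in vt|rewrite mulr0].
  by apply/funext => v; rewrite big_cons.
move=> v; rewrite -[RHS](congr1 (@^~ v) (sumE s)); congr (iter n B _ v).
apply/funext => w; have [ws|/[dup] ws /fs fw] := boolP (w \in s).
  rewrite (bigD1_seq w)//= /delta eqxx mulr1 big1 ?addr0// => x.
  by rewrite eq_sym => /negbTE ->; rewrite mulr0.
rewrite fw big_seq big1// => x xs; rewrite /delta.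
by case: eqP => [wx|_]; [rewrite wx xs in ws|rewrite mulr0].
Qed.

(** The n-th iterate moves the values up by n levels, so it only sees the
    values of a function from level n on. *)
Lemma iter_shift_eq_above (lev : A -> nat) n f g :
  (forall a b, E a b -> lev b = (lev a).+1) ->
  (forall u, (n <= lev u)%N -> f u = g u) -> iter n B f = iter n B g.
Proof.
move=> levE fg.
suff above k : (k <= n)%N -> forall v, (n - k <= lev v)%N ->
    iter k B f v = iter k B g v.
  by apply/funext => v; apply: above; rewrite ?subnn.
elim: k => [|k IHk] kn v vk; first by apply: fg; rewrite -(subn0 n).
rewrite !iterS /Bshift.
have -> // : shift_term E lam (iter k B f) v = shift_term E lam (iter k B g) v.
apply/funext => u; rewrite /shift_term /patch.
case: ifPn => // /set_mem /levE uv; rewrite IHk ?(ltnW kn)// uv.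
by move: vk; rewrite !leq_subLR addSn addnS.
Qed.

(** * Large weights along long paths *)

Lemma weight_path_le n v u : Chin E n v u ->
  forall M : R, 0 <= M ->
  (forall k f, lp p f ->
    (lpnorm p (iter k B f) <= (M ^+ k)%:E * lpnorm p f)%E) ->
  cmod (weight_path E lam n u) <= M ^+ n.
Proof.
move=> vu M M0 hM; rewrite -lee_fin.
have -> : weight_path E lam n u = iter n B (delta u) v.
  by rewrite iter_shift_delta; case: asboolP.
apply: le_trans (le_cmod_lpnorm _ v p0) _.
apply: le_trans (hM n _ (lp_delta u p1)) _.
rewrite -[leRHS]mule1; apply: lee_wpmul2l; first by rewrite lee_fin exprn_ge0.
exact: lpnorm_delta.
Qed.

Definition growing_weights : Prop :=
  forall (s : seq A) (K : R) (L : nat), exists2 n, (L <= n)%N &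
    forall v, v \in s -> exists2 u, Chin E n v u &
      K < cmod (weight_path E lam n u).

(** The length of the paths may be required to be large because paths of
    length [n] have weights at most [M ^+ n], where [M] bounds the operator:
    asking for a weight above [M ^+ L] excludes the lengths below [L]. For this
    there must be at least one vertex, hence the additional vertex [r]. *)
Lemma growing_weights_of_cvg (n_ : nat -> nat) (r : A) :
  (forall v : A, (fun k => ereal_sup
     [set (cmod (weight_path E lam (n_ k) u))%:E | u in Chin E (n_ k) v])
     @ \oo --> +oo%E) -> growing_weights.
Proof.
move=> wy s K L; have [M M1 hM] := shift_bound.
have M0 : 0 <= M by rewrite (le_trans _ M1).
pose K' := Num.max K (M ^+ L).
have [k hk] : exists k, forall v, v \in r :: s ->
    exists2 u, Chin E (n_ k) v u & K' < cmod (weight_path E lam (n_ k) u).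
  have [k hk] : exists k, forall v, v \in r :: s ->
    (K'%:E < ereal_sup
     [set (cmod (weight_path E lam (n_ k) u))%:E | u in Chin E (n_ k) v])%E.
    suff : \forall k \near \oo, forall v, v \in r :: s ->
      (K'%:E < ereal_sup
       [set (cmod (weight_path E lam (n_ k) u))%:E | u in Chin E (n_ k) v])%E.
      exact: filter_ex.
    elim: (r :: s) => [|x t IHt]; first by near=> k.
    have /cvgeyPgt/(_ K') hx := wy x.
    near=> k => v; rewrite inE => /orP[/eqP ->|vt]; first by near: k.
    by move: v vt; near: k.
  exists k => v vs; have /ereal_sup_gt[_ [u vu <-]] := hk v vs.
  by rewrite lte_fin => Ku; exists u.
exists (n_ k) => [|v vs].
  rewrite leqNgt; apply/negP => nL; have [|u ru] := hk r.
    by rewrite inE eqxx.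
  apply/negP; rewrite -leNgt.
  apply: le_trans (weight_path_le ru M0 (fun k f fp => (hM k f fp).2)) _.
  by rewrite le_max (ler_weXn2l M1 (ltnW nL)) orbT.
have [|u vu] := hk v; first by rewrite inE vs orbT.
by rewrite gt_max => /andP[Ku _]; exists u.
Unshelve. all: by end_near. Qed.

(** [iter n B g v] is the sum of the [g u] weighted by the paths from [v] to
    [u]. For a finitely supported [g] this is [iter_shift_support], and the
    bound passes to the limit because the iterate is bounded. *)
Lemma iter_shift_le (S s : R) n g v :
  (\esum_(u in [set: A]) (cmod (g u))%:E <= S%:E)%E -> 0 <= s ->
  (forall u, Chin E n v u -> cmod (weight_path E lam n u) <= s) ->
  cmod (iter n B g v) <= s * S.
Proof.
move=> gS s0 ws; have [M M1 hM] := shift_bound.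
have Mn0 : 0 < M ^+ n by rewrite exprn_gt0// (lt_le_trans _ M1).
have gp : lp p g by apply: (lp_of_esum p1); exact: le_lt_trans gS (ltry _).
apply/ler_addgt0Pr => e e0.
have [|t [ut ht]] := lp_tail p1 gp (e := e / M ^+ n); first by rewrite divr_gt0.
pose g1 : A -> R[i] := fun u => if u \in t then g u else 0.
pose g2 : A -> R[i] := fun u => if u \in t then 0 else g u.
have gE : g = g1 + g2.
  apply/funext => u; rewrite -[RHS]/(g1 u + g2 u) /g1 /g2.
  by case: ifP; rewrite ?addr0 ?add0r.
have g1t u : u \notin t -> g1 u = 0 by rewrite /g1 => /negbTE ->.
have g1p : lp p g1 by exact: lp_support g1t.
have g2p : lp p g2 by exact: le_lt_trans ht (ltry _).
rewrite gE iter_shiftD//.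
apply: le_trans (cmodD _ _) _; apply: lerD; last first.
  rewrite -lee_fin; apply: le_trans (le_cmod_lpnorm _ v p0) _.
  apply: le_trans (hM n _ g2p).2 _.
  apply: (@le_trans _ _ ((M ^+ n)%:E * (e / M ^+ n)%:E)%E).
    by rewrite lee_wpmul2l// lee_fin ltW.
  by rewrite -EFinM lee_fin mulrC divfK// gt_eqF.
rewrite (iter_shift_support n ut g1t).
apply: le_trans (cmod_sum _ _ _) _.
apply: (@le_trans _ _ (\sum_(u <- t) s * cmod (g u))).
  rewrite big_seq [leRHS]big_seq; apply: ler_sum => u ut'.
  rewrite cmodM mulrC /g1 ut' ler_wpM2r ?cmod_ge0// iter_shift_delta.
  by case: asboolP => [/ws//|_]; rewrite cmod0.
rewrite -mulr_sumr ler_wpM2l// -lee_fin; apply: le_trans gS.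
apply: esum_ge; exists [set` t]; first by split; first exact: finite_seq.
by rewrite -fsbig_seq// sumEFin.
Qed.

(** If [p <= m], the m-th power of a p-summable function has a finite sum [S],
    so the modulus of its n-th image at [v] is at most [S] times the largest
    weight of a path of length [n] from [v]. The orbit approximates functions
    that are large on any finite set of vertices, which forces large weights. *)
Lemma cvg_of_hypercyclic_power (r : A) (m : nat) f : p <= m%:R -> lp p f ->
  HC p B (f ^+ m) -> exists n_ : nat -> nat,
    (forall k, (0 < n_ k)%N) /\
    (forall v : A, (fun k => ereal_sup
       [set (cmod (weight_path E lam (n_ k) u))%:E | u in Chin E (n_ k) v])
       @ \oo --> +oo%E).
Proof.
move=> pm fp [_ dense_orbit].
have powE v : (f ^+ m) v = f v ^+ m.
  by elim: (m) => [|k IHk]//; rewrite !exprS -IHk.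
pose c := fine (lpnorm p f).
have [S S0 hS] : exists2 S : R, 0 <= S &
    (\esum_(u in [set: A]) (cmod ((f ^+ m) u))%:E <= S%:E)%E.
  exists (c `^ (m%:R - p) * c `^ p); first by rewrite mulr_ge0 ?powR_ge0.
  rewrite EFinM -power_sum_fine// -esum_mulr ?powR_ge0//; last first.
    by move=> v; exact: powR_ge0.
  apply: le_esum => v _; rewrite lee_fin powE cmodX -powR_mulrn ?cmod_ge0//.
  rewrite -{1}(subrK p m%:R) powRD; last first.
    by rewrite subrK gt_eqF// (lt_le_trans p0).
  rewrite ler_wpM2r ?powR_ge0// ge0_ler_powR ?subr_ge0 ?nnegrE ?cmod_ge0//.
    exact: fine_lpnorm_ge0.
  exact: lp_bounded.
(* A value within 1 of [K k] exceeds [k.+1 * S]. The vertex [r] is in all the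
   finite sets considered, so that [n_ k = 0], for which the only weight is 1,
   is impossible. *)
pose K k : R := k.+1%:R * (S + 1) + 1.
have K0 k : 0 <= k.+1%:R * (S + 1) :> R by rewrite mulr_ge0// addr_ge0.
have target k : exists n, (0 < n)%N /\
    forall v : A, (choice.pickle v <= k + choice.pickle r)%N ->
      exists2 u, Chin E n v u & k.+1%:R < cmod (weight_path E lam n u).
  pose h (v : A) : R[i] :=
    if (choice.pickle v <= k + choice.pickle r)%N then (K k)%:C%C else 0.
  have hp : lp p h.
    pose s : seq A := pmap choice.unpickle (iota 0 (k + choice.pickle r).+1).
    apply: (@lp_support _ _ p s) => //.
    move=> v; rewrite /h; case: leqP => // vk; rewrite mem_pmap.
    move=> /mapP; case; exists (choice.pickle v); last first.
      by rewrite choice.pickleK.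
    by rewrite mem_iota.
  have [_ [n _ <-] hn] := dense_orbit h hp 1 ltr01.
  have big (v : A) : (choice.pickle v <= k + choice.pickle r)%N ->
      exists2 u, Chin E n v u & k.+1%:R < cmod (weight_path E lam n u).
    move=> vk; apply: contrapT => small.
    have : cmod (iter n B (f ^+ m) v) <= k.+1%:R * S.
      apply: iter_shift_le hS _ _ => // u vu; rewrite leNgt; apply/negP => ku.
      by apply: small; exists u.
    have : cmod (h v - iter n B (f ^+ m) v) < 1.
      rewrite -lte_fin; apply: le_lt_trans hn.
      exact: (le_cmod_lpnorm (h - _)).
    have := cmodD (h v - iter n B (f ^+ m) v) (iter n B (f ^+ m) v).
    rewrite subrK {1}/h vk cmod_real ger0_norm ?addr_ge0// /K.
    rewrite mulrDr mulr1; have : 0 < k.+1%:R :> R by [].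
    lra.
  exists n; split=> //; case: n hn big => // hn /(_ r (leq_addl _ _))[u _].
  by rewrite /weight_path big_ord0 cmod1 ltNge ler1n.
have [n_ hn] := choice target; exists n_.
split=> [k|v]; first by have [] := hn k.
apply/cvgeyPge => K1; near=> k.
have [_ /(_ v)[|u vu ku]] := hn k.
  by rewrite (@leq_trans k) ?leq_addr//; near: k; exact: nbhs_infty_ge.
apply: (@le_trans _ _ (k.+1%:R)%:E).
  rewrite lee_fin (@le_trans _ _ k%:R)// ?ler_nat//.
  by near: k; exact: nbhs_infty_ger.
apply: (@le_trans _ _ (cmod (weight_path E lam (n_ k) u))%:E).
  by rewrite lee_fin ltW.
by apply: ereal_sup_ubound; exists u.
Unshelve. all: by end_near. Qed.

(** * Construction of the generators *)

(** A block [t] consists of tiny values [tau v] at the ends of long paths of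
    large weight [w] from the vertices [v] of the support of a target [g]. As
    [tau v] is an [m.+1]-th root of [g v / w], the iterate [n] sends the power
    [t ^+ m.+1] to [g] exactly. A relative error of order [t] in this power
    remains a relative error of that order in the image. All this holds at the
    same time for all the functions [b] with the same leading term, which is
    why a countable family of blocks is enough for uncountably many
    polynomials. *)
Lemma exists_block (lev : A -> nat) (g : A -> R[i]) (s : seq A) (m L : nat)
    (r d e : R) :
  growing_weights -> uniq s -> (forall v, v \notin s -> g v = 0) ->
  0 <= r -> 0 < d -> 0 < e ->
  exists n n' (t : A -> R[i]), [/\ (L <= n)%N,
    forall u, t u != 0 -> (lev u < n')%N /\ exists v, Chin E n v u,
    (\esum_(u in [set: A]) (cmod (t u))%:E <= d%:E)%E &
    forall b : A -> R[i],
      (forall u, cmod (b u - t u ^+ m.+1) <= r * cmod (t u) ^+ m.+2) ->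
      lp p b /\ (lpnorm p (iter n B b - g)%R <= e%:E)%E].
Proof.
move=> grow us gs r0 d0 e0.
pose G := \sum_(v <- s) cmod (g v).
have G0 : 0 <= G by apply: sumr_ge0 => v _; exact: cmod_ge0.
have leG v : v \in s -> cmod (g v) <= G.
  move=> vs; rewrite /G (big_rem v)//= lerDl.
  by apply: sumr_ge0 => w _; exact: cmod_ge0.
pose dl := Num.min (d / (size s).+1%:R) (e / (r * G + 1)).
have rG0 : 0 < r * G + 1 by rewrite ltr_wpDl// mulr_ge0.
have dl0 : 0 < dl by rewrite lt_min !divr_gt0.
have [n Ln hn] := grow s (G / dl ^+ m.+1) L.
pose w := weight_path E lam n.
have /choice[sg sgP] v : exists u, v \in s ->
    Chin E n v u /\ G / dl ^+ m.+1 < cmod (w u).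
  have [vs|_] := boolP (v \in s); last by exists v.
  by have [u vu wu] := hn v vs; exists u.
have sg_inj : {in s &, injective sg}.
  move=> v v' /sgP[vc _] /sgP[vc' _] ee; rewrite ee in vc.
  exact: (Chin_inj treeE vc vc').
pose tau v : R[i] := m.+1.-root (g v / w (sg v)).
have tauX v : tau v ^+ m.+1 = g v / w (sg v) by rewrite rootCK.
have Gdl : 0 <= G / dl ^+ m.+1 by rewrite divr_ge0// exprn_ge0// ltW.
have w0 v : v \in s -> 0 < cmod (w (sg v)).
  by move=> /sgP[_]; exact: le_lt_trans.
have tau_le v : v \in s -> cmod (tau v) <= dl.
  move=> vs; have [_ wv] := sgP v vs.
  rewrite -(@ler_pXn2r _ m.+1) ?nnegrE ?cmod_ge0// ?(ltW dl0)//.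
  rewrite -cmodX tauX cmodM cmodV ler_pdivrMr ?w0//.
  apply: le_trans (leG v vs) _; rewrite mulrC -ler_pdivrMr ?exprn_gt0//.
  exact: ltW.
pose t u := \sum_(v <- s | sg v == u) tau v.
have t_sg v : v \in s -> t (sg v) = tau v.
  move=> vs; rewrite /t -big_filter (_ : seq.filter _ s = [:: v]) ?big_seq1//.
  rewrite -(filter_pred1_uniq us vs); apply: eq_in_filter => x xs /=.
  by apply/eqP/eqP => [|->//]; exact: sg_inj.
pose s' := [seq sg v | v <- s].
have us' : uniq s' by rewrite map_inj_in_uniq.
have ts' u : u \notin s' -> t u = 0.
  move=> us'u; rewrite /t big_seq_cond big1// => v /andP[vs /eqP vu].
  by case/negP: us'u; rewrite -vu map_f.
exists n, (\max_(u <- s') lev u).+1, t; split=> //.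
- move=> u tu; have : u \in s' by apply: contraNT tu => /ts' ->.
  move=> us'u; split; first by rewrite ltnS; apply: leq_bigmax_seq.
  by have /mapP[v vs ->] := us'u; exists v; have [] := sgP v vs.
- rewrite (esum_support us') => [|v|v /ts' ->]; [|exact: cmod_ge0|exact: cmod0].
  rewrite lee_fin big_map; apply: (@le_trans _ _ (\sum_(v <- s) dl)).
    rewrite big_seq [leRHS]big_seq; apply: ler_sum => v vs.
    by rewrite t_sg// tau_le.
  rewrite big_const_seq count_predT iter_addr_0 -[dl *+ _]mulr_natr.
  apply: (@le_trans _ _ (dl * (size s).+1%:R)).
    by rewrite ler_wpM2l ?ler_nat// ltW.
  by rewrite -ler_pdivlMr// ge_min lexx.
move=> b bt.
have bs' u : u \notin s' -> b u = 0.
  move=> /ts' tu; apply/eqP; rewrite -cmod_eq0 eq_le cmod_ge0 andbT.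
  by have := bt u; rewrite tu cmod0 !expr0n/= subr0 mulr0.
split; first exact: lp_support bs'.
pose q v := b (sg v) * w (sg v).
have BbE x : iter n B b x = if x \in s then q x else 0.
  rewrite (iter_shift_support n us' bs') big_map.
  have term v : v \in s -> v != x -> b (sg v) * iter n B (delta (sg v)) x = 0.
    move=> vs vx; rewrite iter_shift_delta; case: asboolP => [xv|_]; last first.
      by rewrite mulr0.
    by case/eqP: vx; apply: (Chin_inj treeE _ xv); have [] := sgP v vs.
  case: ifPn => xs; last first.
    rewrite big_seq big1// => v vs; apply: term => //.
    by apply: contraNneq xs => <-.
  rewrite (bigD1_seq x)//= big_seq_cond big1 => [|v /andP[]]; last exact: term.
  rewrite addr0 iter_shift_delta; case: asboolP => // nxs.
  by case: nxs; have [] := sgP x xs.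
apply: le_trans (lpnorm_le_esum _ p1) _.
rewrite (esum_support us) => [|v|v vs]; [|exact: cmod_ge0|]; last first.
  by rewrite -[(_ - _) v]/(iter n B b v - g v) BbE (negbTE vs) gs// subr0 cmod0.
rewrite lee_fin; apply: (@le_trans _ _ (\sum_(v <- s) r * dl * cmod (g v))).
  rewrite big_seq [leRHS]big_seq; apply: ler_sum => v vs.
  rewrite -[(_ - _) v]/(iter n B b v - g v) BbE vs /q.
  have wn0 : w (sg v) != 0 by rewrite -cmod_gt0 w0.
  have gE : g v = tau v ^+ m.+1 * w (sg v) by rewrite tauX divfK.
  rewrite [in leLHS]gE -mulrBl cmodM -t_sg//.
  apply: le_trans (ler_wpM2r (cmod_ge0 _) (bt (sg v))) _.
  rewrite t_sg//.
  have -> : r * cmod (tau v) ^+ m.+2 * cmod (w (sg v)) =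
      r * cmod (tau v) * cmod (g v).
    by rewrite [in RHS]gE cmodM cmodX exprS !mulrA.
  by rewrite ler_wpM2r ?cmod_ge0// ler_wpM2l// tau_le.
rewrite -mulr_sumr -/G.
apply: (@le_trans _ _ (dl * (r * G + 1))).
  by rewrite mulrDr mulr1 mulrAC (mulrC (r * G)) lerDl ltW.
by rewrite -ler_pdivlMr// ge_min lexx orbT.
Qed.

(** The data of one block [blk] for the iterate [len]. The block lives on the
    levels from [len] on and below [top]. Its sum is at most [budget], and
    [next] is the budget of the block after it. *)
Record block_data := BlockData {
  len : nat ; top : nat ; budget : R ; next : R ; blk : A -> R[i] }.

(** Each block starts above all the previous ones, where the functions
    numbered [i < N k], of depth [dep i], have ended. The budgets decrease so
    fast that the iterate [n k], of norm at most [M ^+ n k], makes the sum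
    of all the later blocks, even multiplied by [r k], as small as the error of
    the block itself. *)
Lemma exists_blocks (lev : A -> nat) (M : R) (dep N m r : nat -> nat)
    (c : nat -> code) :
  growing_weights -> 1 <= M ->
  (forall a b, E a b -> lev b = (lev a).+1) ->
  exists (n : nat -> nat) (t : nat -> A -> R[i]) (d : nat -> R),
  [/\ forall k, (n k < n k.+1)%N /\ forall i, (i < N k)%N -> (dep i <= n k)%N,
      forall k u, t k u != 0 -> (n k <= lev u < n k.+1)%N,
      d 0%N = 2^-1 /\ forall k, [/\ 0 < d k, d k.+1 *+ 2 <= d k &
        M ^+ n k * (r k).+1%:R ^+ 2 * (d k.+1 *+ 2) <= 1],
      forall k, (\esum_(u in [set: A]) (cmod (t k u))%:E <= (d k)%:E)%E &
      forall k (b : A -> R[i]),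
        (forall u, cmod (b u - t k u ^+ (m k).+1)
                     <= (r k)%:R * cmod (t k u) ^+ (m k).+2) ->
        lp p b /\ (lpnorm p (iter (n k) B b - code_fun (c k))%R
                     <= ((r k).+1%:R^-1)%:E)%E].
Proof.
move=> grow M1 levE.
pose good k (L : nat) (dl : R) (y : block_data) :=
  [/\ (L <= len y < top y)%N /\ (forall i, (i < N k)%N -> (dep i <= len y)%N),
    forall u, blk y u != 0 -> (len y <= lev u < top y)%N,
    [/\ budget y = dl, 0 < next y, next y *+ 2 <= budget y &
      M ^+ len y * (r k).+1%:R ^+ 2 * (next y *+ 2) <= 1],
    (\esum_(u in [set: A]) (cmod (blk y u))%:E <= (budget y)%:E)%E &
    forall (b : A -> R[i]),
      (forall u, cmod (b u - blk y u ^+ (m k).+1)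
                   <= (r k)%:R * cmod (blk y u) ^+ (m k).+2) ->
      lp p b /\ (lpnorm p (iter (len y) B b - code_fun (c k))%R
                     <= ((r k).+1%:R^-1)%:E)%E].
have step (a : nat * nat * R) : exists y, 0 < a.2 -> good a.1.1 a.1.2 a.2 y.
  case: a => -[k L] dl /=; have [dl0|_] := ltP 0 dl; last first.
    by exists (BlockData 0 0 0 0 (fun=> 0)).
  have supp v : v \notin undup [seq x.1 | x <- c k] ->
      code_fun (c k) v = 0 :> R[i].
    by rewrite mem_undup; exact: code_fun_support.
  have rk0 : 0 < (r k).+1%:R^-1 :> R by rewrite invr_gt0.
  have [n [n' [t [Ln tn' td tB]]]] := exists_block lev (m k)
    (maxn L (\max_(i < N k) dep i)) grow (undup_uniq _) supp (ler0n _ (r k))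
    dl0 rk0.
  pose q : R := M ^+ n * (r k).+1%:R ^+ 2.
  have q0 : 0 < q by rewrite mulr_gt0 ?exprn_gt0// (lt_le_trans _ M1).
  (* The sum of all the later budgets is at most twice the next one, hence the
     division by 2. *)
  exists (BlockData n (maxn n.+1 n') dl (Num.min dl q^-1 / 2) t) => _.
  move: Ln; rewrite geq_max => /andP[Ln depn].
  split=> /=.
  - split; first by rewrite Ln leq_maxl.
    move=> i iN; apply: leq_trans depn.
    exact: (leq_bigmax (Ordinal iN) (F := fun i : 'I_(N k) => dep i)).
  - move=> u /tn'[un' [v vu]]; rewrite (Chin_level levE vu) leq_addl/=.
    by rewrite -(Chin_level levE vu) leq_max un' orbT.
  - have half (z : R) : (z / 2) *+ 2 = z by rewrite -[_ *+ 2]mulr_natr divfK.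
    rewrite half; split=> //; first by rewrite divr_gt0// lt_min dl0 invr_gt0.
      by rewrite ge_min lexx.
    rewrite -/q; apply: (@le_trans _ _ (q * q^-1)); last first.
      by rewrite mulfV// gt_eqF.
    by rewrite ler_pM2l// ge_min lexx orbT.
  - exact: td.
  - exact: tB.
have [F FP] := choice step.
pose x := fix x k : block_data := if k is k'.+1
  then F (k, top (x k'), next (x k')) else F (0%N, 0%N, 2^-1).
have xP k : good k (if k is k'.+1 then top (x k') else 0%N)
    (if k is k'.+1 then next (x k') else 2^-1) (x k).
  elim: k => [|k IHk].
    by apply: (FP (0%N, 0%N, 2^-1)); rewrite /= invr_gt0.
  by apply: (FP (k.+1, top (x k), next (x k))); case: IHk => _ _ [].
exists (len \o x), (blk \o x), (budget \o x); split=> /=.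
- move=> k; have [[/andP[_ kL] dk] _ _ _ _] := xP k; split=> //.
  have [[/andP[Lk _] _] _ _ _ _] := xP k.+1.
  exact: leq_trans kL Lk.
- move=> k u tu; have [_ /(_ u tu)/andP[nu uL] _ _ _] := xP k.
  have [[/andP[Lk _] _] _ _ _ _] := xP k.+1.
  by rewrite nu (leq_trans uL Lk).
- split=> [|k]; first by have [_ _ [] ] := xP 0%N.
  have [_ _ [-> _ _ _] _ _] := xP k.+1.
  have [_ _ [dE next0 next2 nextM] _ _] := xP k.
  split=> //; apply: lt_le_trans next2.
  by rewrite pmulrn_lgt0.
- by move=> k; have [] := xP k.
- by move=> k; have [] := xP k.
Qed.

Section Glueing.
Context {lev : A -> nat} {n : nat -> nat} {t : nat -> A -> R[i]}.
Context {d : nat -> R} {N : nat -> nat} {y : nat -> A -> R[i]}.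
Context {dep : nat -> nat} {M : R}.
Hypothesis levE : forall a b, E a b -> lev b = (lev a).+1.
Hypothesis hM : forall k f, lp p f ->
  (lpnorm p (iter k B f) <= (M ^+ k)%:E * lpnorm p f)%E.
Hypothesis M0 : 0 <= M.
Hypothesis n_lt : forall k, (n k < n k.+1)%N.
Hypothesis t_level : forall k u, t k u != 0 -> (n k <= lev u < n k.+1)%N.
Hypothesis d_init : d 0%N = 2^-1.
Hypothesis d_gt0 : forall k, 0 < d k.
Hypothesis d_half : forall k, d k.+1 *+ 2 <= d k.
Hypothesis t_sum : forall k,
  (\esum_(u in [set: A]) (cmod (t k u))%:E <= (d k)%:E)%E.
Hypothesis y_dep : forall i v, (dep i <= lev v)%N -> y i v = 0.

(** At most one block is nonzero at [u], and the blocks [t k] with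
    [k > lev u] vanish there, so this is the modulus of the sum of all the
    blocks. *)
Definition tail_bound (u : A) : R := \sum_(k < (lev u).+1) cmod (t k u).

(** On the k-th block, with [x := t k u], the values of the functions [glued i]
    of small depth form the point [(x ^+ ((N k).+1 ^ i))_i] of a Kronecker
    curve. *)
Definition glued (i : nat) (u : A) : R[i] :=
  if (lev u < dep i)%N then y i u
  else \sum_(k < (lev u).+1) t k u ^+ ((N k).+1 ^ i).

Let n_le : {homo n : k l / (k <= l)%N}.
Proof.
by apply: homo_leq => [//|k l q|k]; [exact: leq_trans|exact: ltnW].
Qed.

Let n_ge k : (k <= n k)%N.
Proof. by elim: k => // k IHk; exact: leq_ltn_trans (n_lt k). Qed.

Lemma block_disjoint k j u :
  (n k <= lev u < n k.+1)%N -> j != k -> t j u = 0.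
Proof.
move=> /andP[nu un] jk; apply/eqP; apply: contraNT jk => /t_level/andP[nju unj].
rewrite eqn_leq; apply/andP; split; rewrite leqNgt; apply/negP => /n_le h.
  by move: (leq_trans (leq_trans un h) nju); rewrite ltnn.
by move: (leq_trans (leq_trans unj h) nu); rewrite ltnn.
Qed.

Lemma tail_bound_ge0 u : 0 <= tail_bound u.
Proof. by apply: sumr_ge0 => k _; exact: cmod_ge0. Qed.

(** The budgets [d k] are at least halved at each step, so the blocks from
    the j-th on have total sum at most [2 * d j]. *)
Lemma tail_bound_sum j :
  (\esum_(u in [set: A]) (if (n j <= lev u)%N then tail_bound u else 0)%:E
     <= (d j *+ 2)%:E)%E.
Proof.
have geometric K : \sum_(i < K) d (j + i)%N + d (j + K)%N *+ 2 <= d j *+ 2.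
  elim: K => [|K IHK]; first by rewrite big_ord0 add0r addn0.
  apply: le_trans IHK; rewrite big_ord_recr/= -addrA lerD2l addnS.
  by rewrite [leRHS]mulr2n lerD2l d_half.
apply: ge_ereal_sup => _ [X [finX _] <-].
rewrite fsbig_finite//= sumEFin lee_fin.
pose s := fset_set X; pose K := (\max_(u <- s) lev u).+1.
apply: le_trans (geometric K); rewrite -[leLHS]addr0.
apply: lerD; last by rewrite mulrn_wge0// ltW.
apply: (@le_trans _ _ (\sum_(u <- s) \sum_(i < K) cmod (t (j + i)%N u))).
  rewrite big_seq [leRHS]big_seq; apply: ler_sum => u us.
  case: leqP => [nju|_]; last by apply: sumr_ge0 => i _; exact: cmod_ge0.
  have uK : ((lev u).+1 <= j + K)%N.
    apply: leq_trans (leq_addl _ _); rewrite ltnS.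
    exact: (leq_bigmax_seq (F := lev)).
  apply: (@le_trans _ _ (\sum_(k < j + K) cmod (t k u))).
    rewrite -(subnKC uK) big_split_ord/= lerDl.
    by apply: sumr_ge0 => i _; exact: cmod_ge0.
  rewrite big_split_ord/= big1 ?add0r// => k _.
  apply/eqP; rewrite cmod_eq0; apply: contraTT nju => /t_level/andP[_ uk].
  by rewrite -ltnNge (leq_trans uk)// n_le.
rewrite exchange_big/=; apply: ler_sum => i _.
rewrite -lee_fin; apply: le_trans (t_sum _).
by apply: esum_ge; exists X => //; rewrite fsbig_finite//= sumEFin.
Qed.


Lemma tail_bound_sum1 : (\esum_(u in [set: A]) (tail_bound u)%:E <= 1)%E.
Proof.
apply: (@le_trans _ _ (d 0%N *+ 2)%:E); last first.
  by rewrite d_init lee_fin -[_ *+ 2]mulr_natr mulVf.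
apply: le_trans (tail_bound_sum 0%N); apply: le_esum => u _; rewrite lee_fin.
rewrite /tail_bound; case: leqP => // un; rewrite big1// => k _.
apply/eqP; rewrite cmod_eq0.
apply: contraTT un => /t_level/andP[nku _]; rewrite -leqNgt.
by apply: leq_trans nku; exact: n_le.
Qed.

Lemma tail_bound_le1 u : tail_bound u <= 1.
Proof.
rewrite -lee_fin; apply: le_trans tail_bound_sum1; apply: esum_ge.
by exists [set u]; [split|rewrite fsbig_set1].
Qed.

Lemma block_le k u : cmod (t k u) <= tail_bound u.
Proof.
have [ku|uk] := ltnP k (lev u).+1.
  rewrite /tail_bound (bigD1 (Ordinal ku))//= lerDl.
  by apply: sumr_ge0 => i _; exact: cmod_ge0.
have -> : t k u = 0; last by rewrite cmod0 tail_bound_ge0.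
apply/eqP; apply: contraTT uk => /t_level/andP[nku _]; rewrite -ltnNge ltnS.
exact: leq_trans (n_ge k) nku.
Qed.

Lemma block_le1 k u : cmod (t k u) <= 1.
Proof. exact: le_trans (block_le k u) (tail_bound_le1 u). Qed.

Lemma glued_le i u : (dep i <= lev u)%N -> cmod (glued i u) <= tail_bound u.
Proof.
move=> iu; rewrite /glued ltnNge iu/=.
apply: le_trans (cmod_sum _ _ _) _; apply: ler_sum => k _.
by rewrite cmodX ler_iXnr ?cmod_ge0 ?expn_gt0 ?block_le1.
Qed.

Lemma glued_near i u : cmod (glued i u - y i u) <= tail_bound u.
Proof.
have [iu|ui] := leqP (dep i) (lev u); first by rewrite y_dep// subr0 glued_le.
by rewrite /glued ui subrr cmod0 tail_bound_ge0.
Qed.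

Lemma lpnorm_tail_bound x (q : R) : 0 <= q ->
  (forall u, cmod (x u) <= q * tail_bound u) -> (lpnorm p x <= q%:E)%E.
Proof.
move=> q0 xq; apply: le_trans (lpnorm_le_esum _ p1) _.
apply: (@le_trans _ _ (\esum_(u in [set: A]) (q * tail_bound u)%:E)%E).
  by apply: le_esum => u _; rewrite lee_fin.
rewrite esum_mulr//; last exact: tail_bound_ge0.
by rewrite -[leRHS]mule1 lee_wpmul2l// tail_bound_sum1.
Qed.

Lemma lp_glued i : lp p (y i) -> lp p (glued i).
Proof.
move=> yp; have -> : glued i = y i + (glued i - y i) by rewrite addrC subrK.
apply: lpD => //; apply: le_lt_trans (ltry 1).
by apply: lpnorm_tail_bound => // u; rewrite mul1r; exact: glued_near.
Qed.

Lemma glued_on_block k i u : (dep i <= n k)%N -> (n k <= lev u < n k.+1)%N ->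
  glued i u = t k u ^+ ((N k).+1 ^ i).
Proof.
move=> ik uk; have /andP[ku _] := uk.
have klev : (k < (lev u).+1)%N by rewrite ltnS (leq_trans (n_ge k)).
rewrite /glued ltnNge (leq_trans ik ku)/= (bigD1 (Ordinal klev))//=.
rewrite big1 ?addr0// => j jk; rewrite (block_disjoint uk)//.
by rewrite expr0n expn_eq0.
Qed.

(** The iterate [n k] of the shift ignores the values of [F] at the glued
    functions below level [n k]. Those on the k-th block are close to
    [a * t k u ^+ m.+1], which the iterate sends near [a * g]. Those on the
    later blocks are small with respect to the norm of this iterate. *)
Lemma glued_orbit k (s m q : nat) (a : R[i]) (r : R) (g : A -> R[i])
    (F : ('I_s -> R[i]) -> R[i]) :
  (forall i : 'I_s, (dep i <= n k)%N) ->
  M ^+ n k * q.+1%:R ^+ 2 * (d k.+1 *+ 2) <= 1 ->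
  (forall b : A -> R[i],
    (forall u, cmod (b u - t k u ^+ m.+1) <= q%:R * cmod (t k u) ^+ m.+2) ->
    lp p b /\ (lpnorm p (iter (n k) B b - g)%R <= (q.+1%:R^-1)%:E)%E) ->
  a != 0 -> r / cmod a <= q%:R ->
  (forall z (e : R), 0 <= e <= 1 -> (forall i, cmod (z i) <= e) ->
    cmod (F z) <= r * e) ->
  (forall x, cmod x <= 1 ->
    cmod (F (fun i => x ^+ ((N k).+1 ^ i)) - a * x ^+ m.+1)
      <= r * cmod x ^+ m.+2) ->
  exists2 w, (lpnorm p w <= (2 / q.+1%:R)%:E)%E &
    iter (n k) B (fun u => F (fun i => glued i u)) =
      (fun v => a * (g v + w v)).
Proof.
move=> dep_n nM tB a0 rq F_le F_curve.
have ca0 : 0 < cmod a by rewrite cmod_gt0.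
pose x u := F (fun i => glued i u).
pose b u := if (n k <= lev u < n k.+1)%N then a^-1 * x u else 0.
pose z u := if (n k.+1 <= lev u)%N then a^-1 * x u else 0.
have b_le u : cmod (b u - t k u ^+ m.+1) <= q%:R * cmod (t k u) ^+ m.+2.
  rewrite /b; case: ifP => uk; last first.
    have -> : t k u = 0; last by rewrite cmod0 !expr0n/= subr0 cmod0 mulr0.
    by apply/eqP; apply: contraFT uk => /t_level.
  have -> : x u = F (fun i => t k u ^+ ((N k).+1 ^ i)).
    by congr F; apply/funext => i; exact: glued_on_block.
  rewrite -[X in _ - X](mulKf a0) -mulrBr cmodM cmodV mulrC ler_pdivrMr//.
  apply: le_trans (F_curve _ (block_le1 k u)) _.
  rewrite mulrAC ler_wpM2r ?exprn_ge0 ?cmod_ge0//.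
  by rewrite -ler_pdivrMr.
have [bp Bb] := tB b b_le.
have z_le : (lpnorm p z <= (q%:R * (d k.+1 *+ 2))%:E)%E.
  apply: le_trans (lpnorm_le_esum _ p1) _; rewrite EFinM.
  apply: le_trans (lee_wpmul2l _ (tail_bound_sum k.+1)); last first.
    by rewrite lee_fin.
  rewrite -esum_mulr//; last first.
    by move=> u; case: ifP => // _; exact: tail_bound_ge0.
  apply: le_esum => u _; rewrite lee_fin /z; case: ifP => uk; last first.
    by rewrite cmod0 mulr0.
  have Fu : cmod (x u) <= r * tail_bound u.
    apply: F_le => [|i]; first by rewrite tail_bound_ge0 tail_bound_le1.
    apply: glued_le; apply: leq_trans (dep_n i) _.
    by apply: leq_trans uk; exact: ltnW.
  rewrite cmodM cmodV mulrC ler_pdivrMr//; apply: le_trans Fu _.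
  by rewrite mulrAC ler_wpM2r ?tail_bound_ge0// -ler_pdivrMr.
have zp : lp p z by exact: le_lt_trans z_le (ltry _).
have Bz : (lpnorm p (iter (n k) B z) <= (q.+1%:R^-1)%:E)%E.
  apply: le_trans (hM (n k) zp) _.
  have Mn0 : 0 <= M ^+ n k by rewrite exprn_ge0.
  apply: le_trans (lee_wpmul2l _ z_le) _; first by rewrite lee_fin.
  rewrite -EFinM lee_fin -[leRHS]mul1r ler_pdivlMr//.
  apply: le_trans nM.
  have -> : M ^+ n k * (q%:R * (d k.+1 *+ 2)) * q.+1%:R =
    M ^+ n k * (q.+1%:R * q%:R) * (d k.+1 *+ 2) by ring.
  rewrite ler_wpM2r ?mulrn_wge0 ?(ltW (d_gt0 _))// ler_wpM2l//.
  by rewrite expr2 ler_wpM2l// ler_nat.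
exists ((iter (n k) B b - g) + iter (n k) B z).
  apply: le_trans (lpnormD _ _ p1) _.
  rewrite (_ : 2 / q.+1%:R = q.+1%:R^-1 + q.+1%:R^-1); last first.
    by rewrite mulr_natl mulr2n.
  by rewrite EFinD; apply: leeD.
have -> : iter (n k) B (fun u => F (fun i => glued i u)) =
    iter (n k) B (fun u => a * (b + z) u).
  apply: (iter_shift_eq_above levE) => u ku.
  rewrite -[(b + z) u]/(b u + z u) /b /z ku/= -/(x u).
  by case: ltnP => _; rewrite ?addr0 ?add0r mulVKf.
rewrite iter_shiftZ; last exact: lpD.
rewrite iter_shiftD//; apply/funext => v; congr (a * _).
rewrite -[RHS]/(g v + ((iter (n k) B b v - g v) + iter (n k) B z v)).
by rewrite addrA (addrC (g v)) subrK.
Qed.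

End Glueing.

(** The function [F] stands for a polynomial without constant term: it is
    small near 0 and has a leading term along a Kronecker curve. The blocks
    are indexed by the codes of all the tasks: the base [N.+1] of the curve, the
    order [m.+1] of the leading term, a bound [r_] for the other constants, and
    a target. The functions [glued i] are dense up to scalars because the [y i]
    are arbitrarily large multiples of the members of a countable dense
    set, while the blocks added to them have a bounded sum. *)
Lemma exists_dense_orbits (lev : A -> nat) :
  growing_weights -> (forall a b, E a b -> lev b = (lev a).+1) ->
  exists f : nat -> A -> R[i],
  [/\ forall i, lp p (f i),
    forall h, lp p h -> forall e : R, 0 < e ->
      exists i (a : R[i]), (lpnorm p (h - (fun v => a * f i v))%R < e%:E)%E &
    forall (d N m : nat) (a : R[i]) (r : R) (F : ('I_d -> R[i]) -> R[i]),
      (d <= N)%N -> a != 0 -> 0 <= r ->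
      (forall z (s : R), 0 <= s <= 1 -> (forall i, cmod (z i) <= s) ->
        cmod (F z) <= r * s) ->
      (forall t, cmod t <= 1 ->
        cmod (F (fun i => t ^+ (N.+1 ^ i)) - a * t ^+ m.+1)
          <= r * cmod t ^+ m.+2) ->
      lp_dense p (range (fun n => iter n B (fun v => F (fun i => f i v))))].
Proof.
move=> grow levE; have [M M1 hM] := shift_bound.
have M0 : 0 <= M by rewrite (le_trans _ M1).
pose y (i : nat) : A -> R[i] := if @choice.unpickle (nat * @code A)%type i
  is Some (K, c) then fun v => K.+1%:R * code_fun c v else 0.
have /choice[dep y_dep] i : exists l, forall v, (l <= lev v)%N -> y i v = 0.
  rewrite /y; case: choice.unpickle => [[K c]|]; last by exists 0%N.
  exists (\max_(x <- c) lev x.1).+1 => v cv.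
  rewrite code_fun_support ?mulr0//; apply: contraTN cv => /mapP[x xc ->].
  by rewrite -ltnNge ltnS; exact: (leq_bigmax_seq (F := fun x => lev x.1)).
have yp i : lp p (y i).
  rewrite /y; case: choice.unpickle => [[K c]|]; last exact: lp0.
  apply: (@lp_support _ _ p [seq x.1 | x <- c]) => // v vc.
  by rewrite code_fun_support// mulr0.
pose task (k : nat) : nat * nat * nat * @code A := odflt (0, 0, 0, [::])%N
  (@choice.unpickle (nat * nat * nat * @code A)%type k).
pose N_ k := (task k).1.1.1; pose m_ k := (task k).1.1.2.
pose r_ k := (task k).1.2; pose c_ k := (task k).2.
have [n [t [dl [nP tn [dl0 dlP] tdl tB]]]] :=
  exists_blocks dep N_ m_ r_ c_ grow M1 levE.
have n_lt k : (n k < n k.+1)%N by have [] := nP k.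
have d0 k : 0 < dl k by have [] := dlP k.
have d2 k : dl k.+1 *+ 2 <= dl k by have [] := dlP k.
pose f := @glued lev t N_ y dep.
have f_near i u : cmod (f i u - y i u) <= tail_bound u :=
  glued_near n_lt tn dl0 d0 d2 tdl y_dep i u.
exists f; split.
- by move=> i; exact: (lp_glued n_lt tn dl0 d0 d2 tdl y_dep (yp i)).
- move=> h hp e e0; have e20 : 0 < e / 2 by rewrite divr_gt0.
  have [c hc] := code_dense p1 hp e20.
  pose K := Num.truncn (e / 2)^-1.
  have Ke : (K.+1%:R^-1 : R) <= e / 2.
    by rewrite invf_ple ?posrE// ltW// truncnS_gt.
  exists (@choice.pickle (nat * @code A)%type (K, c)), K.+1%:R^-1.
  set i := choice.pickle _.
  have yE : y i = (fun v => K.+1%:R * code_fun c v).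
    by rewrite /y choice.pickleK.
  have K0 : (K.+1%:R : R[i]) != 0 by rewrite pnatr_eq0.
  have -> : h - (fun v => K.+1%:R^-1 * f i v) = (h - code_fun c) +
      (fun v => - K.+1%:R^-1 * (f i v - y i v)).
    apply/funext => v.
    rewrite -[LHS]/(h v - K.+1%:R^-1 * f i v).
    rewrite -[RHS]/(h v - code_fun c v + - K.+1%:R^-1 * (f i v - y i v)).
    by rewrite yE mulNr mulrBr mulKf// opprB addrA subrK.
  apply: le_lt_trans (lpnormD _ _ p1) _.
  have -> : e = e / 2 + e / 2 by field.
  have le2 : (lpnorm p (fun v => - K.+1%:R^-1 * (f i v - y i v))%R
      <= (e / 2)%:E)%E.
    apply: (lpnorm_tail_bound n_lt tn dl0 d0 d2 tdl (ltW e20)) => u.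
    rewrite cmodM cmodN cmodV cmod_nat.
    by rewrite ler_pM ?invr_ge0 ?cmod_ge0 ?f_near.
  rewrite EFinD; apply: (lte_leD (lpnorm_fin _) hc le2).
  exact: le_lt_trans le2 (ltry _).
move=> s N m a r F sN a0 r0 F_le F_curve h hp e e0.
have ca0 : 0 < cmod a by rewrite cmod_gt0.
have ea0 : 0 < e / cmod a / 2 by rewrite !divr_gt0.
have hap : lp p (fun v => a^-1 * h v) by exact: lpZ.
have [c hc] := code_dense p1 hap ea0.
(* Dividing by [a] makes the leading coefficient 1 and the other constant at
   most [q]; moreover [q] is so large that the error [2 / q.+1] of the block is
   negligible. *)
pose q := (Num.truncn (Num.max (r / cmod a) (e / cmod a / 4)^-1)).+1.
have : Num.max (r / cmod a) (e / cmod a / 4)^-1 < q%:R by exact: truncnS_gt.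
rewrite gt_max => /andP[/ltW rq eq4].
have {}eq4 : q.+1%:R^-1 <= e / cmod a / 4.
  rewrite invf_ple ?posrE ?divr_gt0//.
  by apply: le_trans (ltW eq4) _; rewrite ler_nat.
pose k := @choice.pickle (nat * nat * nat * @code A)%type (N, m, q, c).
have taskE : task k = (N, m, q, c) by rewrite /task choice.pickleK.
have dep_n (i : 'I_s) : (dep i <= n k)%N.
  by have [_] := nP k; apply; rewrite /N_ taskE (leq_trans (ltn_ord i)).
have [_ _] := dlP k; have := tB k.
rewrite /c_ /r_ /m_ taskE/= => tBk nM.
have F_curve' x : cmod x <= 1 ->
    cmod (F (fun i => x ^+ ((N_ k).+1 ^ i)) - a * x ^+ m.+1)
      <= r * cmod x ^+ m.+2.
  by rewrite /N_ taskE; exact: F_curve.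
have [w w_le BxE] := glued_orbit (y := y) levE (fun j f fp => (hM j f fp).2)
  M0 n_lt tn dl0 d0 d2 tdl dep_n nM tBk a0 rq F_le F_curve'.
exists (iter (n k) B (fun u => F (fun i => f i u))); first by exists (n k).
have -> : h - iter (n k) B (fun u => F (fun i => f i u)) = (fun v => a *
    (((fun v => a^-1 * h v) - code_fun c) - w) v).
  apply/funext => v; rewrite BxE -[LHS]/(h v - a * (code_fun c v + w v)).
  rewrite -[RHS]/(a * ((a^-1 * h v - code_fun c v) - w v)).
  by field.
rewrite lpnormZ//.
apply: (@lt_le_trans _ _ ((cmod a)%:E *
    ((e / cmod a / 2)%:E + (2 / q.+1%:R)%:E))%E).
  rewrite lte_pmul2l ?lte_fin//; apply: le_lt_trans (lpnormD _ _ p1) _.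
  rewrite lpnormN; apply: lte_leD => //.
  by apply: lpnorm_fin; exact: le_lt_trans w_le (ltry _).
rewrite -EFinD -EFinM lee_fin mulrC -ler_pdivlMr//.
by move: (q.+1%:R^-1) (e / cmod a) eq4 => X Y; lra.
Qed.

End Shift.

(** * Free generators *)

Section Generators.
Context {R : realType} {A : countType} {E : A -> A -> Prop}.
Context {lam : A -> R[i]} {p : R}.
Hypothesis p1 : 1 <= p.
Local Notation B := (Bshift E lam).
Local Notation C := R[i].

Lemma zero_orbit_not_dense (r : A) :
  ~ lp_dense p (range (fun n => iter n B (0 : A -> C))).
Proof.
move=> /(_ (delta r) (lp_delta r p1) 1 ltr01) [_ [n _ <-]].
rewrite iter_shift0 subr0 ltNge; apply/negP/negPn.
apply: le_trans (le_cmod_lpnorm _ r (lt_le_trans ltr01 p1)).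
by rewrite /delta eqxx cmod1.
Qed.

Context {f : nat -> A -> C}.
Hypothesis f_lp : forall i, lp p (f i).
Hypothesis f_dense : forall h, lp p h -> forall e : R, 0 < e ->
  exists i (a : C), (lpnorm p (h - (fun v => a * f i v))%R < e%:E)%E.
Hypothesis f_hc : forall d (P : mpoly.mpoly d C),
  P != 0 -> mpoly.mcoeff mpoly.mnm0 P = 0 ->
  lp_dense p (range (fun n => iter n B (mpoly_fun P (fun i : 'I_d => f i)))).
Variable r : A.

Lemma mpoly_fun_neq0 d (P : mpoly.mpoly d C) :
  P != 0 -> mpoly.mcoeff mpoly.mnm0 P = 0 ->
  mpoly_fun P (fun i : 'I_d => f i) <> 0.
Proof.
move=> P0 Pc P_eq0; have := f_hc P0 Pc.
by rewrite P_eq0; exact: zero_orbit_not_dense.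
Qed.

Lemma generators_independent : alg_independent (range f).
Proof.
move=> d g P _ g_inj gf P0 Pc.
have /choice[k fk] i : exists k, f k = g i by have [k _ <-] := gf i; exists k.
pose D := (\max_(i < d) k i).+1.
have kD i : (k i < D)%N by rewrite ltnS; exact: leq_bigmax.
pose sg i : 'I_D := Ordinal (kD i).
have [Q [QP Q0]] := mpoly_rename sg P.
have sg_inj : injective sg.
  by move=> i j /(congr1 val)/= kij; apply: g_inj; rewrite -!fk kij.
have -> : mpoly_fun P g = mpoly_fun Q (fun i : 'I_D => f i).
  apply/funext => v; rewrite /mpoly_fun QP; apply: mpoly.meval_eq => i.
  by rewrite /= fk.
apply: mpoly_fun_neq0; first exact: Q0.
rewrite -meval_zero QP -[RHS]Pc -meval_zero; exact: mpoly.meval_eq.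
Qed.

(** A difference of two variables is a nonzero polynomial without constant
    term. *)
Lemma generators_injective : injective f.
Proof.
move=> j k fjk; apply/eqP/negPn/negP => jk.
pose D := (maxn j k).+1.
have jD : (j < D)%N by rewrite ltnS leq_maxl.
have kD : (k < D)%N by rewrite ltnS leq_maxr.
pose P : mpoly.mpoly D C := mpoly.mpolyX C (mpoly.mnm1 (Ordinal jD)) -
  mpoly.mpolyX C (mpoly.mnm1 (Ordinal kD)).
have evalP w : mpoly.meval w P = w (Ordinal jD) - w (Ordinal kD).
  by rewrite mpoly.mevalB !mpoly.mevalXU.
apply: (@mpoly_fun_neq0 D P).
- apply: contraNneq jk => P0; apply/eqP.
  have := evalP (fun i => (val i)%:R); rewrite P0 mpoly.meval0 /=.
  by move/esym/eqP; rewrite subr_eq0 eqr_nat => /eqP.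
- by rewrite -meval_zero evalP subrr.
- by apply/funext => v; rewrite /mpoly_fun evalP /= fjk subrr.
Qed.

(** An upper bound for the algebra generated by the functions [f i]: it is
    closed under the operations because two polynomials can be given the same
    variables. *)
Definition polynomial_values : set (A -> C) := [set g | lp p g /\
  exists d (P : mpoly.mpoly d C), mpoly.meval (fun=> 0) P = 0 /\
    g = mpoly_fun P (fun i : 'I_d => f i)].

Lemma common_variables d1 d2 (P : mpoly.mpoly d1 C) (Q : mpoly.mpoly d2 C) :
  exists D (P' Q' : mpoly.mpoly D C),
    [/\ mpoly_fun P' (fun i : 'I_D => f i) = mpoly_fun P (fun i : 'I_d1 => f i),
        mpoly_fun Q' (fun i : 'I_D => f i) = mpoly_fun Q (fun i : 'I_d2 => f i),
        mpoly.meval (fun=> 0) P' = mpoly.meval (fun=> 0) P &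
        mpoly.meval (fun=> 0) Q' = mpoly.meval (fun=> 0) Q].
Proof.
have [P' [P'E _]] := mpoly_rename (widen_ord (leq_maxl d1 d2)) P.
have [Q' [Q'E _]] := mpoly_rename (widen_ord (leq_maxr d1 d2)) Q.
exists (maxn d1 d2), P', Q'; split; rewrite ?P'E ?Q'E//.
- by apply/funext => v; rewrite /mpoly_fun P'E.
- by apply/funext => v; rewrite /mpoly_fun Q'E.
Qed.

Lemma polynomial_values_subalgebra : lp_subalgebra p polynomial_values.
Proof.
have p0 : 0 < p by rewrite (lt_le_trans _ p1).
split.
- by move=> g [].
- split; first exact: lp0.
  exists 0%N, 0; rewrite mpoly.meval0; split=> //.
  by apply/funext => v; rewrite /mpoly_fun mpoly.meval0.
- move=> g h [gp [d1 [P [P0 gP]]]] [hp [d2 [Q [Q0 hQ]]]].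
  split; first exact: lpD.
  have [D [P' [Q' [PE QE P0E Q0E]]]] := common_variables P Q.
  exists D, (P' + Q'); rewrite mpoly.mevalD P0E Q0E P0 Q0 addr0; split=> //.
  rewrite gP hQ -PE -QE; apply/funext => v.
  by rewrite /mpoly_fun mpoly.mevalD.
- move=> c g [gp [d [P [P0 gP]]]]; split; first exact: lpZ.
  exists d, (c *: P); rewrite mpoly.mevalZ P0 mulr0; split=> //.
  by rewrite gP; apply/funext => v; rewrite /mpoly_fun mpoly.mevalZ.
- move=> g h [gp [d1 [P [P0 gP]]]] [hp [d2 [Q [Q0 hQ]]]].
  split; first exact: lpM.
  have [D [P' [Q' [PE QE P0E Q0E]]]] := common_variables P Q.
  exists D, (P' * Q'); rewrite mpoly.mevalM P0E P0 mul0r; split=> //.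
  rewrite gP hQ -PE -QE; apply/funext => v.
  by rewrite /mpoly_fun mpoly.mevalM.
Qed.

Lemma generated_algebra_hypercyclic :
  exists S : set (A -> C),
    [/\ hypercyclic_algebra p B S, lp_dense p S & countably_generated_free p S].
Proof.
pose S := smallest (lp_subalgebra p) (range f).
have fS i : S (f i) by move=> X [_ fX]; apply: fX; exists i.
have S_sub : S `<=` polynomial_values.
  move=> g; apply; split; first exact: polynomial_values_subalgebra.
  move=> _ [i _ <-]; split=> //.
  exists i.+1, (mpoly.mpolyX C (mpoly.mnm1 ord_max)).
  rewrite mpoly.mevalXU; split=> //; apply/funext => v.
  by rewrite /mpoly_fun mpoly.mevalXU.
have algS : lp_subalgebra p S.
  split.
  - by move=> g /S_sub[].
  - by move=> X [[]].
  - move=> g h Sg Sh X [algX fX].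
    by apply: (subalgebraD algX); [exact: Sg|exact: Sh].
  - by move=> c g Sg X [algX fX]; apply: (subalgebraZ algX); exact: Sg.
  - move=> g h Sg Sh X [algX fX].
    by apply: (subalgebraM algX); [exact: Sg|exact: Sh].
exists S; split.
- split=> //.
    move=> S0; have := fS 0%N; have := fS 1%N; rewrite S0/= => f1 f0.
    by have := generators_injective (etrans f0 (esym f1)).
  move=> g /S_sub[gp [d [P [P0 gP]]]].
  have [PE|PE] := eqVneq P 0.
    by right; rewrite gP PE; apply/funext => v; rewrite /mpoly_fun mpoly.meval0.
  left; split=> //; rewrite gP; apply: f_hc => //.
  by rewrite -meval_zero.
- move=> h hp e e0; have [i [a ha]] := f_dense hp e0.
  exists (fun v => a * f i v) => //.
  exact: (subalgebraZ algS).
- exists (range f); split=> //; last exact: generators_independent.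
  by apply: inj_card_eq => i j _ _; exact: generators_injective.
Qed.

End Generators.

(** * The characterization *)

Theorem theorem3p1 (R : realType) (A : countType) (E : A -> A -> Prop)
    (treeE : directed_tree E) (rootedE : rooted E) (leaflessE : leafless E)
    (p : R) (p_ge1 : 1 <= p)
    (lam : A -> R[i]) (lam_neq0 : forall v, lam v != 0)
    (bounded_B : Bshift_bounded E lam p) :
  [<->
    (exists S : set (A -> R[i]),
       [/\ hypercyclic_algebra p (Bshift E lam) S, lp_dense p S &
           countably_generated_free p S]);
    (exists S : set (A -> R[i]), hypercyclic_algebra p (Bshift E lam) S);
    (exists (m : nat) (f : A -> R[i]),
       [/\ p <= m%:R, lp p f & HC p (Bshift E lam) (f ^+ m)]);
    (exists n_ : nat -> nat,
       (forall k, (0 < n_ k)%N) /\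
       (forall v : A,
          (fun k => ereal_sup
             [set (cmod (weight_path E lam (n_ k) u))%:E
                | u in Chin E (n_ k) v]) @ \oo --> +oo%E))].
Proof.
have p_gt0 : 0 < p by rewrite (lt_le_trans _ p_ge1).
have [r rootr] := rootedE.
tfae.
- by move=> [S [algS _ _]]; exists S.
- move=> [S [algS S_neq0 S_HC]].
  have [f Sf f_neq0] : exists2 f, S f & f <> 0.
    apply: contrapT => noS; apply: S_neq0; apply/seteqP; split=> [f Sf|_ ->].
      by apply: contrapT => f0; apply: noS; exists f.
    exact: subalgebra0 algS.
  pose m := (Num.truncn p).+1; exists m, f.
  have fmS k : S (f ^+ k.+1).
    elim: k => [|k IHk]; first by rewrite expr1.
    by rewrite exprS; exact: (subalgebraM algS).
  have powE k v : (f ^+ k) v = f v ^+ k.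
    by elim: k => [|k IHk]//; rewrite !exprS -IHk.
  split; [by rewrite ltW// truncnS_gt|exact: subalgebra_lp algS _ Sf|].
  have [//|fm0] := S_HC _ (fmS (Num.truncn p)).
  case: f_neq0; apply/funext => v.
  have /eqP := congr1 (fun g => g v) fm0; rewrite powE.
  by rewrite -[X in _ == X]/(0 : R[i]) expf_eq0 => /andP[_ /eqP].
- move=> [m [f [pm fp HCfm]]].
  exact: (cvg_of_hypercyclic_power treeE p_ge1 bounded_B r pm fp HCfm).
move=> [n_ [_ wy]].
have grow := growing_weights_of_cvg treeE p_ge1 bounded_B r wy.
have [lev levE] := exists_level treeE rootedE.
have [f [f_lp f_dense f_orbit]] :=
  exists_dense_orbits treeE p_ge1 bounded_B grow levE.
apply: (generated_algebra_hypercyclic p_ge1 f_lp f_dense _ r).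
move=> d P P0 Pc.
have [N [m [a [q [dN a0 q0 P_le P_curve]]]]] := kronecker_expansion P0 Pc.
exact: f_orbit dN a0 q0 P_le P_curve.
Qed.
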